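(* Let $M$ be a $C^{\alpha}$ compact manifold over $\mathbf K$, $t\ge0$, $\alpha\in\{t,[t]\}$. Then each continuous automorphism of $Diff^{\alpha}(M)$ belongs to the group of homeomorphisms $Hom(M)$ of $M$, in the sense that for each continuous automorphism $\psi$ of $Diff^\alpha(M)$ there exists $h\in Hom(M)$ such that $\psi(g)=hgh^{-1}$ for each $g\in Diff^\alpha(M)$.
   Context: $\mathbf K$ is a locally compact infinite field with a nontrivial non-Archimedean multiplicative norm. For $U\subset X$ open and $f:U\to Y$ ($X,Y$ topological vector spaces over $\mathbf K$), put $U^{[1]}=\{(x,v,t): x\in U,x+tv\in U\}$, $f^{[1]}(x,v,t)=(f(x+tv)-f(x))/t$ for $t\neq 0$; $f$ is $C^{[1]}$ if it is continuous and $f^{[1]}$ extends continuously to $U^{[1]}$; inductively $U^{[n+1]}=(U^{[n]})^{[1]}$, $f^{[n+1]}=(f^{[n]})^{[1]}$, $\Upsilon^nf=f^{[n]}$, defining class $C^{[n]}$. Similarly $f$ is $C^n$ if it is continuous and the iterated difference quotients in the variable $x$ only, $\Phi^1f=f^{[1]}$, $\Phi^{k+1}f(x;v_1,\dots,v_{k+1};t_1,\dots,t_{k+1})=\Phi^1(\Phi^kf(x;v_1,\dots,v_k;t_1,\dots,t_k))(x;v_{k+1};t_{k+1})$, have continuous extensions $\bar\Phi^kf$, $k\le n$, to $U^{(k)}=\{(x;v_1,\dots,v_k;t_1,\dots,t_k): x\in U,x+v_1t_1\in U,\dots,x+v_1t_1+\dots+v_kt_k\in U\}$. $C^0=C^{[0]}$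 is continuity; $C^\infty=\bigcap C^n$, $C^{[\infty]}=\bigcap C^{[n]}$. Put $S^k=\bar\Phi^k$ for $\alpha=t$, $S^k=\Upsilon^k$ for $\alpha=[t]$. $M$ is modelled on $\mathbf K^d$ with transition maps of class $C^\alpha$. $Diff^\alpha(M)$ is the group of all homeomorphisms $M\to M$ of class $C^\alpha$ in charts, with the $C^\alpha$ compact-open topology (given through charts by uniform convergence on compact sets of $S^kf$ for all finite $k\le t$). $Hom(M)=Hom(M,M)$ is the group of all homeomorphisms of $M$ onto itself.
   Formalization: Dimension d ≥ 1 is assumed (for d = 0 and six points, Diff(M) = S_6 has an outer automorphism, so the claim fails); U^(k) requires all subset sums x + Σ_{i∈J} v_i t_i to lie in U, as otherwise Φ^k f is undefined there. *)

(* Defs.v *)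
From HB Require Import structures.
From mathcomp Require Import all_boot all_order all_algebra.
From mathcomp Require Import all_classical all_reals all_analysis.

Set Implicit Arguments.
Unset Strict Implicit.
Unset Printing Implicit Defensive.

Import Order.TTheory GRing.Theory Num.Theory.

Local Open Scope classical_set_scope.
Local Open Scope ring_scope.

(* Fields with a nontrivial non-Archimedean absolute value, with the topology
   that it defines.  The normed structures of the library do not apply: they
   require |x *+ n| = |x| *+ n, which contradicts the ultrametric
   inequality. *)
HB.mixin Record isNonArchField (R : realType) K
    of GRing.Field K & Topological K := {
  nabs : K -> R ;
  nabs_ge0 : forall x, 0 <= nabs x ;
  nabs_eq0 : forall x, (nabs x == 0) = (x == 0) ;
  nabsM : forall x y, nabs (x * y) = nabs x * nabs y ;
  nabsD : forall x y, nabs (x + y) <= Num.max (nabs x) (nabs y) ;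
  nabs_nontrivial : exists x, x != 0 /\ nabs x != 1 ;
  nabs_nbhsE : forall (x : K) (A : set K),
    nbhs x A <-> exists2 e : R, 0 < e & [set y | nabs (x - y) < e] `<=` A
}.

#[short(type="nonArchFieldType")]
HB.structure Definition NonArchField (R : realType) :=
  { K of isNonArchField R K & GRing.Field K & Topological K }.

(* [Cord t] is the index alpha = t and [Cbr t] the index alpha = [t];
   [None] stands for t = infinity. *)
Variant smoothness := Cord of option nat | Cbr of option nat.

Definition order_of (a : smoothness) : option nat :=
  match a with Cord t => t | Cbr t => t end.

Definition leqx (k : nat) (t : option nat) : bool :=
  if t is Some n then (k <= n)%N else true.

Section ContinuousExtension.
Variables X Y : topologicalType.

(* g is a continuous extension to D of a function q that is only meaningful
   on D `&` E. *)
Definition is_cont_ext (D E : set X) (q g : X -> Y) : Prop :=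
  {within D, continuous g} /\ forall p, D p -> E p -> g p = q p.

(* The continuous extension (unique on D when D `&` E is dense in D and Y is
   Hausdorff), or q itself when there is none. *)
Definition cont_ext (D E : set X) (q : X -> Y) : X -> Y :=
  xget q [set g | is_cont_ext D E q g].

End ContinuousExtension.

Section Differentiability.
Variables (R : realType) (K : nonArchFieldType R).

(* The balls of K^l for the maximum norm. *)
Definition nball l (y : 'rV[K]_l) (e : R) : set 'rV[K]_l :=
  [set z | forall i, nabs (y 0 i - z 0 i) < e].

(* Triples (x, v, t) of K^m x K^m x K are encoded as rows of K^(m + m + 1), so
   that all iterated domains are subsets of spaces of row vectors. *)
Section OneStep.
Variable m : nat.
Implicit Type p : 'rV[K]_(m + m + 1).

Definition qx p : 'rV[K]_m := lsubmx (lsubmx p).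
Definition qv p : 'rV[K]_m := rsubmx (lsubmx p).
Definition qt p : K := rsubmx p 0 0.

Definition qdom (U : set 'rV[K]_m) : set 'rV[K]_(m + m + 1) :=
  [set p | U (qx p) /\ U (qx p + qt p *: qv p)].

Definition quot l (f : 'rV[K]_m -> 'rV[K]_l) p : 'rV[K]_l :=
  (qt p)^-1 *: (f (qx p + qt p *: qv p) - f (qx p)).

End OneStep.

Fixpoint brdim (m n : nat) : nat :=
  if n is n'.+1 then (brdim m n' + brdim m n' + 1)%N else m.

Unset Implicit Arguments.

Section Maps.
Variables m l : nat.
Implicit Types (U : set 'rV[K]_m) (f : 'rV[K]_m -> 'rV[K]_l).

(* U^[n] *)
Fixpoint brdom U (n : nat) : set 'rV[K]_(brdim m n) :=
  match n return set 'rV[K]_(brdim m n) with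
  | 0 => U
  | n'.+1 => qdom (brdom U n')
  end.

(* f^[n] *)
Fixpoint Upsilon U f (n : nat) : 'rV[K]_(brdim m n) -> 'rV[K]_l :=
  match n return 'rV[K]_(brdim m n) -> 'rV[K]_l with
  | 0 => f
  | n'.+1 =>
      cont_ext (brdom U n'.+1) [set p | qt p != 0] (quot (Upsilon U f n'))
  end.

Definition br_class U f (n : nat) : Prop :=
  {within U, continuous f} /\
  forall k, (k < n)%N -> exists g,
    is_cont_ext (brdom U k.+1) [set p | qt p != 0] (quot (Upsilon U f k)) g.

(* Points (x; v_1, .., v_k; t_1, .., t_k); the v_i are the rows of a matrix. *)
Definition phi_space (k : nat) : Type :=
  ('rV[K]_m * 'M[K]_(k, m) * 'rV[K]_k)%type.
HB.instance Definition _ k := Topological.copy (phi_space k)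
  ('rV[K]_m * 'M[K]_(k, m) * 'rV[K]_k)%type.

(* U^(k): the recursion defining the k-th difference quotient evaluates f at
   the points x + \sum_(i in J) t_i v_i for all sets J of indices. *)
Definition phi_dom U (k : nat) : set (phi_space k) :=
  [set p : phi_space k | forall J : {set 'I_k},
     U (p.1.1 + \sum_(i in J) p.2 0 i *: row i p.1.2)].

Fixpoint Phi_rec f (k : nat) :
    'rV[K]_m -> 'M[K]_(k, m) -> 'rV[K]_k -> 'rV[K]_l :=
  match k with
  | 0 => fun x _ _ => f x
  | k'.+1 => fun x V T =>
      let t := T 0 ord_max in
      let v := row ord_max V in
      let F y := Phi_rec f k' y (row' ord_max V) (col' ord_max T) in
      t^-1 *: (F (x + t *: v) - F x)
  end.

Definition Phi f (k : nat) (p : phi_space k) : 'rV[K]_l :=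
  Phi_rec f k p.1.1 p.1.2 p.2.

(* The points where all the t_i are nonzero, so that [Phi] is meaningful. *)
Definition phi_gen (k : nat) : set (phi_space k) :=
  [set p : phi_space k | forall i, p.2 0 i != 0].

Definition Phibar U f (k : nat) : phi_space k -> 'rV[K]_l :=
  cont_ext (phi_dom U k) (phi_gen k) (Phi f k).

Definition ord_class U f (n : nat) : Prop :=
  {within U, continuous f} /\
  forall k, (k <= n)%N -> exists g,
    is_cont_ext (phi_dom U k) (phi_gen k) (Phi f k) g.

Definition Cclass (a : smoothness) U f : Prop :=
  forall n, leqx n (order_of a) ->
    match a with Cord _ => ord_class U f n | Cbr _ => br_class U f n end.

(* S^k f on its domain: Phibar for alpha = t and Upsilon for alpha = [t]. *)
Definition S_space (a : smoothness) (k : nat) : topologicalType :=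
  match a with Cord _ => phi_space k | Cbr _ => 'rV[K]_(brdim m k) end.

Definition S_dom (a : smoothness) U (k : nat) : set (S_space a k) :=
  match a with Cord _ => phi_dom U k | Cbr _ => brdom U k end.

Definition S_quot (a : smoothness) U f (k : nat) : S_space a k -> 'rV[K]_l :=
  match a with Cord _ => Phibar U f k | Cbr _ => Upsilon U f k end.

End Maps.

End Differentiability.

Arguments phi_space {R} K m k.
Arguments S_space {R} K m a k.
Arguments brdom {R K m} U n _.
Arguments Upsilon {R K m l} U f n _.
Arguments br_class {R K m l} U f n.
Arguments phi_dom {R K m} U k _.
Arguments Phi_rec {R K m l} f k _ _ _.
Arguments Phi {R K m l} f k _.
Arguments phi_gen {R K m} k _.
Arguments Phibar {R K m l} U f k _.
Arguments ord_class {R K m l} U f n.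
Arguments Cclass {R K m l} a U f.
Arguments S_dom {R K m} a U k _.
Arguments S_quot {R K m l} a U f k _.

Set Implicit Arguments.

Section Homeo.
Variable M : topologicalType.

Record homeo : Type := Homeo {
  hfun :> M -> M ;
  hinv : M -> M ;
  hfunK : cancel hfun hinv ;
  hinvK : cancel hinv hfun ;
  hfun_cont : continuous hfun ;
  hinv_cont : continuous hinv }.

HB.instance Definition _ := gen_eqMixin homeo.
HB.instance Definition _ := gen_choiceMixin homeo.

Lemma homeo_eq (f g : homeo) : hfun f = hfun g -> f = g.
Proof.
case: f g => [f f' fK f'K cf cf'] [g g' gK g'K cg cg'] /= fg.
move: fK f'K cf; rewrite {}fg => fK f'K cf.
have f'g' : f' = g' by apply/funext => x; rewrite -{1}(g'K x) fK.
move: fK f'K cf'; rewrite {}f'g' => fK f'K cf'.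
by congr Homeo; exact: Prop_irrelevance.
Qed.

Definition homeo_one : homeo :=
  @Homeo id id (fun=> erefl) (fun=> erefl) (fun x => cvg_id) (fun x => cvg_id).

Definition homeo_inv (f : homeo) : homeo :=
  Homeo (hinvK f) (hfunK f) (@hinv_cont f) (@hfun_cont f).

Lemma homeo_comp_cont (f g : M -> M) :
  continuous f -> continuous g -> continuous (f \o g).
Proof. by move=> cf cg x; apply: continuous_comp; [exact: cg|exact: cf]. Qed.

Definition homeo_mul (f g : homeo) : homeo :=
  @Homeo (f \o g) (hinv g \o hinv f)
    (can_comp (hfunK f) (hfunK g)) (can_comp (hinvK g) (hinvK f))
    (homeo_comp_cont (@hfun_cont f) (@hfun_cont g))
    (homeo_comp_cont (@hinv_cont g) (@hinv_cont f)).

Lemma homeo_mulA : associative homeo_mul.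
Proof. by move=> f g h; exact: homeo_eq. Qed.
Lemma homeo_mul1 : left_id homeo_one homeo_mul.
Proof. by move=> f; exact: homeo_eq. Qed.
Lemma homeo_mulr1 : right_id homeo_one homeo_mul.
Proof. by move=> f; exact: homeo_eq. Qed.
Lemma homeo_mulV : left_inverse homeo_one homeo_inv homeo_mul.
Proof. by move=> f; apply: homeo_eq; apply/funext => x /=; rewrite hfunK. Qed.
Lemma homeo_mulrV : right_inverse homeo_one homeo_inv homeo_mul.
Proof. by move=> f; apply: homeo_eq; apply/funext => x /=; rewrite hinvK. Qed.

HB.instance Definition _ := isGroup.Build homeo
  homeo_mulA homeo_mul1 homeo_mulr1 homeo_mulV homeo_mulrV.

End Homeo.

Section Manifold.
Variables (R : realType) (K : nonArchFieldType R) (d : nat).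

Section Charts.
Variable M : topologicalType.

(* A homeomorphism of an open subset of M onto an open subset of K^d; outside
   of these subsets the two functions are arbitrary. *)
Record chart : Type := Chart {
  cdom : set M ;
  cfun : M -> 'rV[K]_d ;
  cinv : 'rV[K]_d -> M ;
  cdom_open : open cdom ;
  cimg_open : open (cfun @` cdom) ;
  cfunK : {in cdom, cancel cfun cinv} ;
  cfun_cont : {within cdom, continuous cfun} ;
  cinv_cont : {within cfun @` cdom, continuous cinv} }.

(* f read in the charts c1 (source) and c2 (target) *)
Definition loc_dom (c1 c2 : chart) (f : M -> M) : set 'rV[K]_d :=
  cfun c1 @` (cdom c1 `&` f @^-1` cdom c2).

Definition loc_map (c1 c2 : chart) (f : M -> M) : 'rV[K]_d -> 'rV[K]_d :=
  cfun c2 \o f \o cinv c1.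

End Charts.

Variable a : smoothness.

(* The condition [atlas_compat] says that the transition maps are C^alpha. *)
Record atlas (M : topologicalType) : Type := Atlas {
  aidx : Type ;
  achart :> aidx -> chart M ;
  atlas_cover : forall x : M, exists i, cdom (achart i) x ;
  atlas_compat : forall i j,
    Cclass a (loc_dom (achart i) (achart j) id)
             (loc_map (achart i) (achart j) id) }.

Variables (M : topologicalType) (A : atlas M).

Definition Cmap (f : M -> M) : Prop :=
  forall i j, Cclass a (loc_dom (A i) (A j) f) (loc_map (A i) (A j) f).

(* A homeomorphism may be C^alpha without its inverse being so; both are
   required to be C^alpha, so that one gets a group. *)
Definition is_diffeo (f : homeo M) : Prop := Cmap f /\ Cmap (f^-1)%g.

Record diffeo : Type := Diffeo {
  dval :> homeo M ;
  dvalP : is_diffeo dval }.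

HB.instance Definition _ := gen_eqMixin diffeo.
HB.instance Definition _ := gen_choiceMixin diffeo.

(* The maps g such that, in the charts A i and A j, S^k g is defined on C and
   is e-close there to S^k f.  For k = 0 this is the usual compact-open
   condition. *)
Definition Copen_ball (f : diffeo) (i j : aidx A) (k : nat)
    (C : set (S_space K d a k)) (e : R) : set diffeo :=
  [set g : diffeo | C `<=` S_dom a (loc_dom (A i) (A j) g) k /\
     forall p, C p ->
       nball (S_quot a (loc_dom (A i) (A j) f) (loc_map (A i) (A j) f) k p) e
            (S_quot a (loc_dom (A i) (A j) g) (loc_map (A i) (A j) g) k p)].

Definition Copen_subbase : set (set diffeo) :=
  [set N | exists (f : diffeo) (i j : aidx A) (k : nat)
     (C : set (S_space K d a k)) (e : R),
     [/\ leqx k (order_of a), compact C,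
         C `<=` S_dom a (loc_dom (A i) (A j) f) k,
         0 < e & N = Copen_ball f i j C e]].

(* The C^alpha compact-open topology. *)
HB.instance Definition _ :=
  @isSubBaseTopological.Build diffeo (set diffeo) Copen_subbase id.

(* The products are taken in the group Hom(M), of which Diff^alpha(M) is a
   subgroup. *)
Definition is_automorphism (psi : diffeo -> diffeo) : Prop :=
  bijective psi /\
  forall f g fg : diffeo, dval fg = (dval f * dval g)%g ->
    dval (psi fg) = (dval (psi f) * dval (psi g))%g.

End Manifold.

(* Main.v *)
Require Import Defs.
From HB Require Import structures.
From mathcomp Require Import all_boot all_order all_algebra.
From mathcomp Require Import all_classical all_reals all_analysis.
From mathcomp Require Import ring.

(** The manifold enters only through two properties of the action of
Diff^alpha(M) on the compact Hausdorff space M: there are no isolated points,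
and for every neighbourhood W of a point x, the diffeomorphisms supported in W
move x onto all the points of some neighbourhood of x.

A group that acts in this way determines the space, by an argument of Rubin in
the form given by Belk, Elliott and Matucci.  The relation [alg_disjoint] is
defined in terms of the group law alone and is close to disjointness of
supports.  It yields a group-theoretic description of the pairs (f, h) such
that the support of h is contained in the closure of the support of f
([bicentralP]); hence an automorphism psi preserves this inclusion, and it
preserves disjointness of supports.  A point x is then sent to the unique
point common to the closures of the supports of psi f, where f runs through
the elements that move x: compactness gives existence, and local transitivity
gives uniqueness ([corresponds_inj]).  This map is a homeomorphism that
conjugates the action into the transported one ([reconstruction]).

Local transitivity comes from translations.  In a chart, the ball of radius e
around the image of x is a coset of a subgroup of K^d, so that a translation by
a vector shorter than e preserves it and moves its centre to an arbitrary point
of it.  A small ball of a chart is closed in M ([clopen_chart_ball]), hence the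
translation extends by the identity to a homeomorphism of M.  That this
homeomorphism is of class C^alpha in all pairs of charts requires that being of
class C^alpha be a local property, stable under composition ([Cmap_atP]).

These two facts are proved simultaneously for the classes C^n and C^[n], by
describing both with one recursion.  The first difference quotient
f^[1](x, v, t) of a map is to be differentiated again with respect to all of
(x, v, t) for the bracket classes, but only with respect to (x, v), for a
constant t, for the others.  The class [mclass] carries along a matrix, the
mask, which records the directions that are currently active.  The chain rule
(f o g)^[1] = f^[1] o (g, g^[1], t) is then an induction ([mclass_comp]), and so
is locality ([mclass_local]).  The comparison with C^[n] is a matter of
unfolding ([br_classP]).  For C^n, where x alone is varied and the directions
and the steps are all kept fixed, one must show that varying the directions
brings nothing new: a variation of v_i is a difference quotient of the same
order with another direction and another step ([dquots_step]). *)

Set Implicit Arguments.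
Unset Strict Implicit.
Unset Printing Implicit Defensive.

Import Order.TTheory GRing.Theory Num.Theory.

Local Open Scope classical_set_scope.

(** * A locally transitive group determines the space on which it acts *)

Section Reconstruction.
Variables (M : topologicalType) (gT : groupType) (act : gT -> M -> M).
Hypotheses (M_hausdorff : hausdorff_space M).
Hypotheses (act1 : forall x, act 1%g x = x)
  (actM : forall g h x, act (g * h)%g x = act g (act h x))
  (act_cont : forall g, continuous (act g))
  (act_faithful : forall g, (forall x, act g x = x) -> g = 1%g).

Definition supp g : set M := [set x | act g x <> x].
Definition rigid (U : set M) g := supp g `<=` U.

Hypothesis no_isolated : forall x (W : set M),
  open W -> W x -> exists2 y, W y & y <> x.
Hypothesis locally_transitive : forall x (W : set M), open W -> W x ->
  exists N, [/\ open N, N x & forall y, N y -> exists2 g, rigid W g & act g x = y].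

Lemma locally_moving x (W : set M) : open W -> W x ->
  exists g, rigid W g /\ supp g x.
Proof.
move=> oW Wx; have [N [oN Nx NP]] := locally_transitive oW Wx.
have [y Ny yx] := no_isolated oN Nx.
by have [g Wg gx] := NP y Ny; exists g; split => //; rewrite /supp /= gx.
Qed.

Lemma actK g : cancel (act g) (act g^-1%g).
Proof. by move=> x; rewrite -actM mulVg act1. Qed.

Lemma actKV g : cancel (act g^-1%g) (act g).
Proof. by move=> x; rewrite -actM mulgV act1. Qed.

Lemma act_inj g : injective (act g).
Proof. exact: can_inj (actK g). Qed.

Lemma act_eq g h : (forall x, act g x = act h x) -> g = h.
Proof.
move=> gh; apply/(mulIg h^-1%g); rewrite mulgV; apply: act_faithful => x.
by rewrite actM gh actKV.
Qed.

Lemma commuteE g h :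
  commute g h <-> forall x, act g (act h x) = act h (act g x).
Proof.
split=> [gh x|gh]; first by rewrite -!actM gh.
by apply: act_eq => x; rewrite !actM.
Qed.

Lemma rigid_fix U g x : rigid U g -> ~ U x -> act g x = x.
Proof. by move=> Ug Ux; apply: contrapT => gx; exact/Ux/Ug. Qed.

Lemma rigid_stable U g x : rigid U g -> U x -> U (act g x).
Proof.
move=> Ug Ux; apply: contrapT => gUx; apply: (gUx).
by have /act_inj -> := rigid_fix Ug gUx.
Qed.

Lemma supp_stable g x : supp g x -> supp g (act g x).
Proof. exact: (@rigid_stable (supp g)). Qed.

Lemma rigidV U g : rigid U g -> rigid U g^-1%g.
Proof. by move=> Ug x gx; apply: Ug => gxE; apply: gx; rewrite -{1}gxE actK. Qed.

Lemma supp_conj g h x : supp h x -> supp (g * h * g^-1)%g (act g x).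
Proof. by move=> hx; rewrite /supp /= !actM actK => /act_inj. Qed.

Lemma closure_supp_conj g h y :
  closure (supp h) y -> closure (supp (g * h * g^-1)%g) (act g y).
Proof.
move=> hy B /(@act_cont g y B)/hy[z [hz Bz]].
by exists (act g z); split => //; exact: supp_conj.
Qed.

Lemma displaced_nbhs g x W : open W -> W x -> act g x <> x ->
  exists V, [/\ open V, V x, V `<=` W & forall z, V z -> ~ V (act g z)].
Proof.
move=> oW Wx gx.
have := M_hausdorff; rewrite open_hausdorff => /(_ x (act g x)) [].
  exact/eqP/nesym.
move=> [A B] /= [/set_mem Ax /set_mem Bgx] [oA oB /eqP AB].
exists (W `&` A `&` act g @^-1` B); split.
- apply: openI; first exact: openI.
  by apply: open_comp => // z _; exact: act_cont.
- by [].
- by move=> z [[]].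
- move=> z [_ Bgz] [[_ Agz] _].
  by have : (A `&` B) (act g z) by []; rewrite AB.
Qed.

Lemma supp_open g : open (supp g).
Proof.
rewrite openE => x gx.
have [V [oV Vx _ gV]] := displaced_nbhs openT I gx.
apply: filterS (open_nbhs_nbhs (conj oV Vx)) => z Vz gz.
by apply: (gV _ Vz); rewrite gz.
Qed.

Lemma disjoint_commute g h : supp g `&` supp h = set0 -> commute g h.
Proof.
move=> gh0; apply/commuteE => x.
have fixg y : supp h y -> act g y = y.
  by move=> hy; apply: contrapT => gy; have : (supp g `&` supp h) y by []; rewrite gh0.
have fixh y : supp g y -> act h y = y.
  by move=> gy; apply: contrapT => hy; have : (supp g `&` supp h) y by []; rewrite gh0.
have [gx|gx] := pselect (supp g x).
  by rewrite (fixh _ gx) (fixh _ (supp_stable gx)).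
have [hx|hx] := pselect (supp h x).
  by rewrite (fixg _ hx) (fixg _ (supp_stable hx)).
by move/contrapT: gx => gx; move/contrapT: hx => hx; rewrite gx hx gx.
Qed.

Lemma disjointP g h : (forall x, supp g x -> act h x = x) ->
  supp g `&` supp h = set0.
Proof. by move=> gh; apply/seteqP; split => // x [/gh]. Qed.

Lemma rigid_disjoint U g h : rigid U g -> U `&` supp h = set0 ->
  supp g `&` supp h = set0.
Proof.
move=> Ug Uh; apply/seteqP; split => // x [/Ug Ux hx].
by rewrite -Uh.
Qed.

(** Implied by disjointness of the supports of f and g, and implying that the
    supports of f and g ^+ 12 are disjoint. *)
Definition alg_disjoint (f g : gT) := forall h, ~ commute f h ->
  exists f1 f2, [/\ commute f1 g, commute f2 g,
    [~ f1, [~ f2, h]]%g <> 1%g & commute [~ f1, [~ f2, h]]%g g].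

Lemma noncommuting_point f h :
  ~ commute f h -> exists2 x, supp f x & act h x <> x.
Proof.
move=> fh; apply: contrapT => nex; apply/fh/disjoint_commute/disjointP => x fx.
by apply: contrapT => hx; apply: nex; exists x.
Qed.

Lemma act_comm g h x :
  act [~ g, h]%g x = act g^-1%g (act h^-1%g (act g (act h x))).
Proof. by rewrite commgEl conjgE !actM. Qed.

(** Take U inside supp f such that h moves U off itself.  For f1 and f2
    supported in U, the map [~ f2, h] agrees with f2^-1 on U, so that
    [~ f1, [~ f2, h]] is the commutator of f1 and f2^-1 : it is supported in U,
    away from supp g. *)
Lemma disjoint_alg_disjoint f g :
  supp f `&` supp g = set0 -> alg_disjoint f g.
Proof.
move=> fg0 h /noncommuting_point [x fx hx].
have [U [oU Ux Uf hU]] := displaced_nbhs (supp_open f) fx hx.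
have gU k : rigid U k -> commute k g.
  move=> Uk; apply: disjoint_commute; apply: rigid_disjoint Uk _.
  by apply/seteqP; split => // z [/Uf fz gz]; rewrite -fg0.
have [f2 [Uf2 f2x]] := locally_moving oU Ux.
have f2Vx : act f2^-1%g x <> x by move=> e; apply: f2x; rewrite -{1}e actKV.
have [V [oV Vx VU f2V]] := displaced_nbhs oU Ux f2Vx.
have [f1 [Vf1 f1x]] := locally_moving oV Vx.
have Uf1 : rigid U f1 by exact: subset_trans VU.
have cU z : U z -> act [~ f2, h]%g z = act f2^-1%g z.
  by move=> Uz; rewrite act_comm (rigid_fix Uf2 (hU z Uz)) actK.
exists f1, f2; split; [exact: gU|exact: gU| |apply: gU => z].
  move=> /eqP/commgP/commuteE/(_ x); rewrite cU// cU; last exact: rigid_stable.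
  by rewrite (rigid_fix Vf1 (f2V _ Vx)) => /act_inj/esym.
rewrite /supp /= act_comm => kz; apply: contrapT => Uz; apply: kz.
suff cz : ~ U (act [~ f2, h]%g z).
  by rewrite (rigid_fix Uf1 cz) actK (rigid_fix (rigidV Uf1) Uz).
move=> Ucz; apply: Uz.
have Uw : U (act f2 (act [~ f2, h]%g z)) by exact: rigid_stable.
suff -> : z = act f2 (act [~ f2, h]%g z) by [].
by apply: (@act_inj [~ f2, h]%g); rewrite (cU _ Uw) actK.
Qed.

Lemma expg_fix g n x : act g x = x -> act (g ^+ n)%g x = x.
Proof. by move=> gx; elim: n => [|n IH]; rewrite ?act1// expgS actM IH. Qed.

(** Let x be in both supports.  As 12 is a multiple of 1, 2, 3 and 4, some
    neighbourhood U of x is disjoint from g^j U for 1 <= j <= 4.  For h supported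
    in U, the support of the double commutator is contained in the union of
    four translates of U by elements that commute with g.  It is stable
    under g, so that two of five consecutive points of a g-orbit are in the
    same translate, against the choice of U. *)
Lemma alg_disjoint_supp f g :
  alg_disjoint f g -> supp f `&` supp (g ^+ 12)%g = set0.
Proof.
move=> fg; apply/seteqP; split => // x [fx gx].
have gjx j : (0 < j <= 4)%N -> act (g ^+ j)%g x <> x.
  move=> j14 gj; apply: gx.
  have -> : 12 = (j * (12 %/ j))%N by case: j j14 {gj} => [|[|[|[|[|j]]]]].
  by rewrite expgnA; exact: expg_fix.
have [U [oU Ux fU gU]] : exists U, [/\ open U, U x,
    forall z, U z -> ~ U (act f z) &
    forall j z, (0 < j <= 4)%N -> U z -> ~ U (act (g ^+ j)%g z)].
  have [U1 [oU1 U1x _ U1g]] := displaced_nbhs openT I (gjx 1 isT).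
  have [U2 [oU2 U2x U21 U2g]] := displaced_nbhs oU1 U1x (gjx 2 isT).
  have [U3 [oU3 U3x U32 U3g]] := displaced_nbhs oU2 U2x (gjx 3 isT).
  have [U4 [oU4 U4x U43 U4g]] := displaced_nbhs oU3 U3x (gjx 4 isT).
  have [U [oU Ux U4' Uf]] := displaced_nbhs oU4 U4x fx.
  exists U; split => // -[|[|[|[|[|j]]]]] z // _ /U4' U4z /U4'.
  - by move=> /U43/U32/U21; apply: U1g; exact/U21/U32/U43.
  - by move=> /U43/U32; apply: U2g; exact/U32/U43.
  - by move=> /U43; apply: U3g; exact/U43.
  - exact: U4g.
have [h [Uh hx]] := locally_moving oU Ux.
have /fg [f1 [f2 [f1g f2g k1 kg]]] : ~ commute f h.
  move=> /commuteE/(_ x); rewrite (rigid_fix Uh (fU x Ux)) => /act_inj.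
  exact: hx.
set k := [~ f1, [~ f2, h]]%g in k1 kg.
have [z kz] : exists z, act k z <> z.
  by apply: contrapT => nex; apply/k1/act_faithful => z;
     apply: contrapT => kz; apply: nex; exists z.
(* The support of k consists of points z with w z in U for one of these w. *)
pose w (a : 'I_4) := nth 1%g [:: 1; f2; f1; f2 * f1]%g a.
have wg a : commute (w a) g.
  rewrite /w; case: a => -[|[|[|[|a]]]] //= _.
    by apply: commute_sym; exact: commute1.
  by apply: commute_sym; apply: commuteM; exact: commute_sym.
have cfix y : ~ U y -> ~ U (act f2 y) -> act [~ f2, h]%g y = y.
  move=> Uy Uf2y.
  by rewrite act_comm (rigid_fix Uh Uy) (rigid_fix (rigidV Uh) Uf2y) actK.
have cover y : act k y <> y -> exists a, U (act (w a) y).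
  move=> ky; apply: contrapT => nex; apply: ky.
  have nU a : ~ U (act (w a) y) by move=> Ua; apply: nex; exists a.
  have := nU (inord 0); have := nU (inord 1); have := nU (inord 2).
  have := nU (inord 3); rewrite /w !inordK//= act1 actM => U3 U2 U1 U0.
  rewrite act_comm (cfix _ U0 U1).
  have e : act [~ f2, h]%g (act f1 y) = act f1 y by exact: cfix.
  by rewrite -{1}e actK actK.
have kgz (i : nat) : act k (act (g ^+ i)%g z) <> act (g ^+ i)%g z.
  have /commuteE -> : commute k (g ^+ i)%g by exact: commuteX.
  by move=> /act_inj.
pose a (i : 'I_5) := projT1 (cid (cover _ (kgz i))).
have aP (i : 'I_5) : U (act (w (a i)) (act (g ^+ i)%g z)).
  exact: (projT2 (cid (cover _ (kgz i)))).
have [i [j [ij aij]]] : exists i j : 'I_5, (i < j)%N /\ a i = a j.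
  apply: contrapT => nex.
  have ainj : injective a.
    move=> i j aij; apply: val_inj; case: (ltngtP (val i) (val j)) => // ij.
      by case: nex; exists i, j.
    by case: nex; exists j, i.
  by have := leq_card a ainj; rewrite !card_ord.
have := aP j; rewrite -aij -(subnK (ltnW ij)) expgnDr actM.
have /commuteE -> : commute (w (a i)) (g ^+ (j - i))%g by exact: commuteX.
apply: gU (aP i); rewrite subn_gt0 ij /=.
by rewrite (leq_trans (leq_subr _ _))// -ltnS ltn_ord.
Qed.

(** Lengthen an orbit segment x, g x, ..., g^n x step by step: the next point can
    only coincide with x, and in this case compose g with an element that moves
    x and is supported away from the other points. *)
Lemma orbit_segment V x n : open V -> V x -> exists g, rigid V g /\
  forall i j, (i < j <= n)%N -> act (g ^+ i)%g x <> act (g ^+ j)%g x.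
Proof.
move=> oV Vx; elim: n => [|n [g [Vg gP]]].
  exists 1%g; split; first by move=> z; rewrite /supp /= act1.
  by move=> i j; case: j => // j; rewrite ltn0 andbF.
suff [k [Vk kE kx]] : exists k, [/\ rigid V k,
    forall i, (0 < i <= n)%N -> act k (act (g ^+ i)%g x) = act (g ^+ i)%g x &
    forall i, (i <= n)%N -> act k (act (g ^+ n.+1)%g x) <> act (g ^+ i)%g x].
  have kgE i : (i <= n)%N -> act ((k * g) ^+ i)%g x = act (g ^+ i)%g x.
    elim: i => // i IH lein.
    by rewrite expgS !actM IH 1?ltnW// -(actM g) -expgS kE.
  exists (k * g)%g; split.
    move=> z kgz; have [gz|/Vg//] := pselect (act g z = z).
    by apply: Vk; move: kgz; rewrite /supp /= actM gz.
  move=> i j /andP[ij]; rewrite leq_eqVlt ltnS => /orP[/eqP jE|jn].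
    rewrite jE ltnS in ij *.
    rewrite kgE// expgS !actM kgE// -(actM g) -expgS; apply: nesym; exact: kx.
  by rewrite !kgE//; [apply: gP; rewrite ij|rewrite ltnW// (leq_trans ij)].
have [[i lein gi]|new] :=
    pselect (exists2 i, (i <= n)%N & act (g ^+ n.+1)%g x = act (g ^+ i)%g x); last first.
  exists 1%g; split; first by move=> z; rewrite /supp /= act1.
  - by move=> i _; rewrite act1.
  - by move=> i lein; rewrite act1 => e; apply: new; exists i.
have i0 : i = 0%N.
  case: i lein gi => // i lein; rewrite !expgS !actM => /act_inj /esym e.
  by case: (gP i n _ e); rewrite lein leqnn.
rewrite i0 act1 in gi.
pose P (i : nat) := ~` [set act (g ^+ i)%g x].
have oP j : open (P j).
  by apply: closed_openC; apply: accessible_closed_set1; exact: hausdorff_accessible.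
have [W [oW Wx WV WP]] : exists W, [/\ open W, W x, W `<=` V &
    forall j, (0 < j <= n)%N -> W `<=` P j].
  have H m : (m <= n)%N -> exists W, [/\ open W, W x, W `<=` V &
      forall j, (0 < j <= m)%N -> W `<=` P j].
    elim: m => [_|m IH ltmn]; first by exists V; split => // -[].
    have [W [oW Wx WV WP]] := IH (ltnW ltmn).
    exists (W `&` P m.+1); split.
    - exact: openI.
    - by split=> // e; have := gP 0%N m.+1 ltmn; rewrite act1; apply.
    - by move=> z [/WV].
    - move=> j /andP[j0]; rewrite leq_eqVlt ltnS => /orP[/eqP->|jm] z [Wz Pz] //.
      by apply: WP Wz; rewrite j0.
  exact: H.
have [k [Wk kx]] := locally_moving oW Wx.
have kfix j : (0 < j <= n)%N -> act k (act (g ^+ j)%g x) = act (g ^+ j)%g x.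
  by move=> jn; apply: (rigid_fix Wk) => /(WP _ jn); apply.
exists k; split => //; first exact: subset_trans WV.
move=> [_|j ltjn]; rewrite gi ?act1//.
by rewrite -(kfix j.+1)// => /act_inj; have := gP 0%N j.+1 ltjn; rewrite act1.
Qed.

Definition bicentral (f h : gT) := forall g, alg_disjoint f g -> commute h (g ^+ 12)%g.

Lemma open_disjoint_closure (U A : set M) :
  open U -> U `&` A = set0 -> U `&` closure A = set0.
Proof.
move=> oU UA; apply/seteqP; split => // z [Uz /(_ U (open_nbhs_nbhs (conj oU Uz)))].
by rewrite setIC UA => -[].
Qed.

Lemma notin_closure (A : set M) x : ~ closure A x ->
  exists V, [/\ open V, V x & V `&` A = set0].
Proof.
move=> Ax; exists (~` closure A); split => //.
  by apply: closed_openC; exact: closed_closure.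
by apply/seteqP; split => // z [Az /subset_closure].
Qed.

(** If h moves some x off the closure of supp f, there is a g supported near x,
    hence algebraically disjoint from f, with g ^+ 12 moving x; its support is
    displaced by h, and so g ^+ 12 does not commute with h. *)
Lemma bicentralP f h : bicentral f h <-> supp h `<=` closure (supp f).
Proof.
split=> [fh x hx|hf g /alg_disjoint_supp fg0].
  apply: contrapT => /notin_closure[V [oV Vx Vf]].
  have [U [oU Ux UV hU]] := displaced_nbhs oV Vx hx.
  have [g [Ug gP]] := orbit_segment 12 oU Ux.
  have /fh : alg_disjoint f g.
    apply: disjoint_alg_disjoint; rewrite setIC.
    exact: rigid_disjoint (subset_trans Ug UV) Vf.
  move=> /commuteE/(_ x); have -> : act (g ^+ 12)%g (act h x) = act h x.
    by apply: expg_fix; exact: rigid_fix Ug (hU x Ux).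
  by move=> /act_inj e; have := gP 0%N 12%N isT; rewrite act1 e.
apply: disjoint_commute; apply: rigid_disjoint hf _; rewrite setIC.
by apply: open_disjoint_closure (supp_open _) _; rewrite setIC.
Qed.

Lemma supp_nonempty g : g <> 1%g -> exists x, supp g x.
Proof.
move=> g1; apply: contrapT => nex; apply/g1/act_faithful => z.
by apply: contrapT => gz; apply: nex; exists z.
Qed.

(** Disjointness of supports is thereby expressed by the group law as well. *)
Lemma disjoint_bicentralP f g : supp f `&` supp g = set0 <->
  forall k, bicentral f k -> bicentral g k -> k = 1%g.
Proof.
split=> [fg0 k /bicentralP kf /bicentralP kg|fg].
  apply: contrapT => /supp_nonempty[x kx].
  have [y [fy ky]] := kf x kx (supp k) (open_nbhs_nbhs (conj (supp_open k) kx)).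
  have [z [gz fz]] := kg y ky (supp f) (open_nbhs_nbhs (conj (supp_open f) fy)).
  by rewrite -[False]/(set0 z) -fg0.
apply/seteqP; split => // x [fx gx].
have [k [kfg kx]] := locally_moving (openI (supp_open f) (supp_open g)) (conj fx gx).
apply: kx; have -> : k = 1%g; last exact: act1.
by apply: fg; apply/bicentralP; apply: subset_trans (@subset_closure _ _) => z /kfg[].
Qed.

Definition inverse_morphisms (psi phi : gT -> gT) :=
  [/\ cancel psi phi, cancel phi psi & {morph psi : g h / (g * h)%g}].

Lemma inverse_morphisms_sym psi phi :
  inverse_morphisms psi phi -> inverse_morphisms phi psi.
Proof.
by move=> [psiK phiK psiM]; split => // g h; rewrite -{1}(phiK g) -{1}(phiK h) -psiM psiK.
Qed.

Lemma morph_1 psi phi : inverse_morphisms psi phi -> psi 1%g = 1%g.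
Proof. by move=> [_ _ psiM]; apply/(mulgI (psi 1%g)); rewrite -psiM !mulg1. Qed.

Lemma morph_V psi phi g : inverse_morphisms psi phi -> psi g^-1%g = (psi g)^-1%g.
Proof.
move=> psi_iso; have [_ _ psiM] := psi_iso.
by apply/(mulgI (psi g)); rewrite -psiM !mulgV (morph_1 psi_iso).
Qed.

Lemma morph_X psi phi g n :
  inverse_morphisms psi phi -> psi (g ^+ n)%g = (psi g ^+ n)%g.
Proof.
move=> psi_iso; have [_ _ psiM] := psi_iso.
by elim: n => [|n IH]; rewrite ?expg0 ?(morph_1 psi_iso)// !expgS psiM IH.
Qed.

Lemma morph_commute psi phi g h :
  inverse_morphisms psi phi -> commute g h -> commute (psi g) (psi h).
Proof. by move=> [_ _ psiM] gh; rewrite /commute -!psiM gh. Qed.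

Lemma morph_alg_disjoint psi phi f g :
  inverse_morphisms psi phi -> alg_disjoint f g -> alg_disjoint (psi f) (psi g).
Proof.
move=> psi_iso fg h fh; have [psiK phiK psiM] := psi_iso.
have [|f1 [f2 [f1g f2g k1 kg]]] := fg (phi h).
  by move=> c; apply: fh; rewrite -(phiK h); exact: (morph_commute psi_iso c).
have psiR x y : psi [~ x, y]%g = [~ psi x, psi y]%g.
  by rewrite !commgEl !conjgE !psiM !(morph_V _ psi_iso).
exists (psi f1), (psi f2).
have -> : [~ psi f1, [~ psi f2, h]]%g = psi [~ f1, [~ f2, phi h]]%g.
  by rewrite !psiR phiK.
split; try exact: morph_commute psi_iso _.
by rewrite -(morph_1 psi_iso) => /(can_inj psiK).
Qed.

Lemma morph_bicentral psi phi f h :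
  inverse_morphisms psi phi -> bicentral f h -> bicentral (psi f) (psi h).
Proof.
move=> psi_iso fh g fg; have [psiK phiK _] := psi_iso.
rewrite -(phiK g) -(morph_X _ _ psi_iso); apply: (morph_commute psi_iso).
apply: fh; rewrite -(psiK f).
exact: (morph_alg_disjoint (inverse_morphisms_sym psi_iso) fg).
Qed.

Lemma morph_supp_closure psi phi f h : inverse_morphisms psi phi ->
  supp h `<=` closure (supp f) -> supp (psi h) `<=` closure (supp (psi f)).
Proof.
by move=> psi_iso /bicentralP hf; apply/bicentralP; exact: (morph_bicentral psi_iso hf).
Qed.

Lemma morph_disjoint psi phi f g : inverse_morphisms psi phi ->
  supp f `&` supp g = set0 -> supp (psi f) `&` supp (psi g) = set0.
Proof.
move=> psi_iso /disjoint_bicentralP fg; have [psiK phiK _] := psi_iso.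
apply/disjoint_bicentralP => k kf kg.
have phi_iso := inverse_morphisms_sym psi_iso.
rewrite -(phiK k) (fg (phi k)) ?(morph_1 psi_iso)//.
- by rewrite -(psiK f); exact: (morph_bicentral phi_iso kf).
- by rewrite -(psiK g); exact: (morph_bicentral phi_iso kg).
Qed.

(** The point y is the one to which psi transports x. *)
Definition corresponds (psi : gT -> gT) x y :=
  forall f, supp f x -> closure (supp (psi f)) y.

(** If x were off the closure of supp (phi w), some f moving x would have a
    support disjoint from that of phi w; then psi f and w have disjoint supports,
    although y belongs to supp w and to the closure of supp (psi f). *)
Lemma corresponds_sym psi phi x y : inverse_morphisms psi phi ->
  corresponds psi x y -> corresponds phi y x.
Proof.
move=> psi_iso xy w wy; have [psiK phiK _] := psi_iso.
apply: contrapT => /notin_closure[V [oV Vx Vw]].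
have [f [Vf fx]] := locally_moving oV Vx.
have := morph_disjoint psi_iso (rigid_disjoint Vf Vw); rewrite phiK => fw.
have [z [fz wz]] := xy f fx _ (open_nbhs_nbhs (conj (supp_open w) wy)).
by rewrite -[False]/(set0 z) -fw.
Qed.

Lemma corresponds_act psi phi x y g : inverse_morphisms psi phi ->
  corresponds psi x y -> corresponds psi (act g x) (act (psi g) y).
Proof.
move=> psi_iso xy f fgx; have [psiK phiK psiM] := psi_iso.
have -> : f = (g * (g^-1 * f * g) * g^-1)%g by rewrite -!mulgA mulgV mulg1 mulVKg.
rewrite 2!psiM (morph_V _ psi_iso); apply: closure_supp_conj; apply: xy.
by have := @supp_conj (g^-1)%g _ _ fgx; rewrite actK invgK.
Qed.

(** If x corresponded to y and to y', with disjoint neighbourhoods W and W',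
    the elements phi k with k supported in W would fix x, so that x would
    correspond to all the points k y, hence to all the points of an open set N.
    For w supported in N, the support of phi w would then be contained in all
    the closures of supports of elements moving x, that is, in {x}. *)
Lemma corresponds_inj psi phi x y y' : inverse_morphisms psi phi ->
  corresponds psi x y -> corresponds psi x y' -> y = y'.
Proof.
move=> psi_iso xy xy'; apply: contrapT => /eqP yy'.
have phi_iso := inverse_morphisms_sym psi_iso.
have [psiK phiK _] := psi_iso.
have := M_hausdorff; rewrite open_hausdorff => /(_ _ _ yy').
move=> [[W W'] /= [/set_mem Wy /set_mem Wy'] [oW oW' /eqP WW']].
have [w' [Ww' w'y']] := locally_moving oW' Wy'.
have xw' : closure (supp (phi w')) x by exact: (corresponds_sym psi_iso xy').
have xfix k : rigid W k -> act (phi k) x = x.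
  move=> Wk; apply: contrapT => kx.
  have kw' : supp k `&` supp w' = set0.
    by apply/seteqP; split => // z [/Wk Wz /Ww' Wz']; rewrite -WW'.
  have [z [w'z kz]] := xw' _ (open_nbhs_nbhs (conj (supp_open (phi k)) kx)).
  by rewrite -[False]/(set0 z) -(morph_disjoint phi_iso kw').
have [N [oN Ny NP]] := locally_transitive oW Wy.
have xN z : N z -> corresponds psi x z.
  move=> /NP[k Wk <-]; rewrite -(xfix k Wk) -{2}(phiK k).
  exact: (@corresponds_act _ _ _ _ (phi k) psi_iso xy).
have [w [Nw wy]] := locally_moving oN Ny.
have [p pw] : exists p, supp (phi w) p.
  apply: supp_nonempty => w1; apply: wy.
  by rewrite -(phiK w) w1 (morph_1 psi_iso) act1.
have [q qw qx] : exists2 q, supp (phi w) q & q <> x.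
  have [px|px] := pselect (p = x); last by exists p.
  by rewrite -px; exact: no_isolated (supp_open _) pw.
move/eqP in qx; have := M_hausdorff; rewrite open_hausdorff => /(_ _ _ qx).
move=> [[A B] /= [/set_mem Aq /set_mem Bx] [oA oB /eqP AB]].
have [f [Bf fx]] := locally_moving oB Bx.
have wf : supp w `<=` closure (supp (psi f)).
  by move=> z /Nw /xN; apply.
have := morph_supp_closure phi_iso wf qw; rewrite psiK.
move=> /(_ A (open_nbhs_nbhs (conj oA Aq)))[z [/Bf Bz Az]].
by rewrite -[False]/(set0 z) -AB.
Qed.

Hypothesis M_compact : compact [set: M].

(** The filter to which [corresponds psi x] is the set of cluster points. *)
Definition image_filter (psi : gT -> gT) x : set_system M :=
  filter_from [set f | supp f x] (fun f => closure (supp (psi f))).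

Lemma image_filter_proper psi phi x : inverse_morphisms psi phi -> ProperFilter (image_filter psi x).
Proof.
move=> psi_iso; have [psiK phiK _] := psi_iso.
apply: filter_from_proper.
  apply: filter_from_filter.
    by have [g [_ gx]] := locally_moving openT (I : setT x); exists g.
  move=> f g /= fx gx.
  have [k [kfg kx]] := locally_moving (openI (supp_open f) (supp_open g)) (conj fx gx).
  exists k => // z kz.
  have mono h : supp k `<=` supp h -> closure (supp (psi h)) z.
    move=> kh; have := morph_supp_closure psi_iso (subset_trans kh (@subset_closure _ _)).
    by move=> /closureS kh'; apply: (@closed_closure _ (supp (psi h))); exact: kh'.
  by split; apply: mono => y /kfg[].
move=> f /= fx; have [|z fz] := @supp_nonempty (psi f).
  move=> f1; apply: fx; rewrite -(psiK f) f1.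
  by rewrite (morph_1 (inverse_morphisms_sym psi_iso)) act1.
by exists z; exact: subset_closure.
Qed.

Lemma image_filter_cluster psi x : cluster (image_filter psi x) = [set y | corresponds psi x y].
Proof.
apply/seteqP; split => y.
  move=> xy f fx B By.
  have fF : image_filter psi x (closure (supp (psi f))) by exists f.
  have [z [fz Bz]] := xy _ _ fF (nbhs_interior By).
  have [u [fu Bu]] := fz _ (Bz : nbhs z B); exists u; split => //.
move=> xy A B [f fx fA] By; have [z [fz Bz]] := xy f fx B By.
by exists z; split => //; apply: fA; exact: subset_closure.
Qed.

Lemma corresponds_ex psi phi x : inverse_morphisms psi phi -> exists y, corresponds psi x y.
Proof.
move=> psi_iso; have PF := image_filter_proper x psi_iso.
have [|y [_ xy]] := M_compact PF; first exact: filterT.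
by exists y; rewrite image_filter_cluster in xy.
Qed.

Lemma corresponds_nbhs psi phi x y N : inverse_morphisms psi phi ->
  corresponds psi x y -> open N -> N y ->
  exists f, supp f x /\ closure (supp (psi f)) `<=` N.
Proof.
move=> psi_iso xy oN Ny; have PF := image_filter_proper x psi_iso.
have : nbhs y `<=` image_filter psi x.
  apply: (@compact_cluster_set1 M y (image_filter psi x) setT) => //.
  - exact: filterT.
  - exact: filterT.
  - rewrite image_filter_cluster; apply/seteqP; split => z /= => [xz|->//].
    exact: corresponds_inj psi_iso xz xy.
by move=> /(_ N (open_nbhs_nbhs (conj oN Ny)))[f fx fN]; exists f.
Qed.

(** The construction is symmetric in [psi] and [phi], whence the inverse map.
    Continuity holds because a filter with a unique cluster point in a compact
    space converges to it. *)
Theorem reconstruction psi phi : inverse_morphisms psi phi ->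
  exists h h' : M -> M, [/\ cancel h h', cancel h' h, continuous h, continuous h' &
    forall g x, h (act g x) = act (psi g) (h x)].
Proof.
move=> psi_iso; have phi_iso := inverse_morphisms_sym psi_iso.
pose h x := projT1 (cid (corresponds_ex x psi_iso)).
have hP x : corresponds psi x (h x) := projT2 (cid (corresponds_ex x psi_iso)).
pose h' x := projT1 (cid (corresponds_ex x phi_iso)).
have h'P x : corresponds phi x (h' x) := projT2 (cid (corresponds_ex x phi_iso)).
have cont a b (ab_iso : inverse_morphisms a b) k : (forall x, corresponds a x (k x)) ->
    continuous k.
  move=> kP x B /nbhs_interior; rewrite nbhsE => -[N [oN Nx] NB].
  have [f [fx fN]] := corresponds_nbhs ab_iso (kP x) oN Nx.
  apply: filterS (open_nbhs_nbhs (conj (supp_open f) fx)) => z fz.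
  exact: interior_subset (NB _ (fN _ (kP _ _ fz))).
exists h, h'; split.
- by move=> x; apply: corresponds_inj phi_iso (h'P _) (corresponds_sym psi_iso (hP x)).
- by move=> x; apply: corresponds_inj psi_iso (hP _) (corresponds_sym phi_iso (h'P x)).
- exact: cont psi_iso _ hP.
- exact: cont phi_iso _ h'P.
- by move=> g x; apply: corresponds_inj psi_iso (hP _) (@corresponds_act _ _ _ _ g psi_iso (hP x)).
Qed.

End Reconstruction.

Local Open Scope ring_scope.

(** * The topology of the field and of matrices over it *)

Section FieldTopology.
Variables (R : realType) (K : nonArchFieldType R).
Implicit Types x y a b : K.

Lemma nabs0 : nabs (0 : K) = 0.
Proof. by apply/eqP; rewrite nabs_eq0. Qed.

Lemma nabs_gt0 x : (0 < nabs x) = (x != 0).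
Proof. by rewrite lt_neqAle nabs_ge0 andbT eq_sym nabs_eq0. Qed.

Lemma nabs1 : nabs (1 : K) = 1.
Proof.
have n1 : nabs (1 : K) != 0 by rewrite nabs_eq0 oner_neq0.
by apply: (mulfI n1); rewrite mulr1 -nabsM mulr1.
Qed.

Lemma nabsN x : nabs (- x) = nabs x.
Proof.
have /eqP : nabs (-1 : K) ^+ 2 = 1 by rewrite expr2 -nabsM mulrNN mulr1 nabs1.
rewrite sqrf_eq1 => /orP[/eqP n1|/eqP n1]; first by rewrite -mulN1r nabsM n1 mul1r.
by have := nabs_ge0 (-1 : K); rewrite n1 ler0N1.
Qed.

Lemma nabsBC x y : nabs (x - y) = nabs (y - x).
Proof. by rewrite -nabsN opprB. Qed.

Lemma nabsD_lt x y (e : R) : nabs x < e -> nabs y < e -> nabs (x + y) < e.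
Proof. by move=> xe ye; apply: le_lt_trans (nabsD x y) _; rewrite gt_max xe ye. Qed.

Lemma nabsV x : nabs x^-1 = (nabs x)^-1.
Proof.
have [->|x0] := eqVneq x 0; first by rewrite invr0 nabs0 invr0.
have nx0 : nabs x != 0 by rewrite nabs_eq0.
by apply: (mulfI nx0); rewrite mulfV// -nabsM mulfV// nabs1.
Qed.

Lemma nabsX x n : nabs (x ^+ n) = nabs x ^+ n.
Proof. by elim: n => [|n IH]; rewrite ?expr0 ?nabs1// !exprS nabsM IH. Qed.

(** Powers of an element of absolute value less than 1. *)
Lemma small_unit (e : R) : 0 < e -> exists2 t : K, t != 0 & nabs t < e.
Proof.
move=> e0.
have [x x0 x1] : exists2 x : K, x != 0 & nabs x < 1.
  have [x [x0]] := @nabs_nontrivial R K.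
  rewrite neq_lt => /orP[x1|x1]; first by exists x.
  by exists x^-1; rewrite ?invr_eq0// nabsV invf_lt1// nabs_gt0.
have : (fun n => nabs x ^+ n : R^o) @ \oo --> (0 : R^o).
  by apply: cvg_expr; rewrite ger0_norm ?nabs_ge0.
move=> /cvgrPdist_lt/(_ e e0)[N _ /(_ N (leqnn N))] /=.
rewrite sub0r normrN ger0_norm ?exprn_ge0 ?nabs_ge0// => xN.
by exists (x ^+ N); rewrite ?expf_neq0// nabsX.
Qed.

Lemma nbhs_punctured a (A : set K) : nbhs a A -> exists2 b, b != a & A b.
Proof.
move=> /nabs_nbhsE[e e0 eA]; have [t t0 te] := small_unit e0.
exists (a + t); first by rewrite -subr_eq0 addrC addKr.
by apply: eA; rewrite /= opprD addNKr nabsN.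
Qed.

Lemma nabs_cvgP T (F : set_system T) (FF : Filter F) (f : T -> K) a :
  f @ F --> a <-> forall e : R, 0 < e -> \forall x \near F, nabs (a - f x) < e.
Proof.
split=> [fa e e0|fa A].
  have : nbhs a [set y | nabs (a - y) < e] by apply/nabs_nbhsE; exists e.
  exact: fa.
by move=> /nabs_nbhsE[e e0 eA]; apply: filterS (fa e e0) => x /eA.
Qed.

Lemma nabs_hausdorff : hausdorff_space K.
Proof.
move=> a b ab; apply/eqP; rewrite -subr_eq0 -nabs_eq0; apply: contrapT => /negP nab.
have e0 : 0 < nabs (a - b) by rewrite lt_neqAle nabs_ge0 andbT eq_sym.
have ball_nbhs (c : K) : nbhs c [set y | nabs (c - y) < nabs (a - b)].
  by apply/nabs_nbhsE; exists (nabs (a - b)).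
have [c [/= ac bc]] := ab _ _ (ball_nbhs a) (ball_nbhs b).
have := nabsD_lt ac (_ : nabs (c - b) < nabs (a - b)).
by rewrite nabsBC addrA subrK ltxx => /(_ bc).
Qed.

Section Limits.
Context {T : Type} {F : set_system T} {FF : Filter F}.
Implicit Types f g : T -> K.

Lemma nabs_cvgD f g a b :
  f @ F --> a -> g @ F --> b -> f x + g x @[x --> F] --> a + b.
Proof.
move=> /nabs_cvgP fa /nabs_cvgP gb; apply/nabs_cvgP => e e0.
near=> x; rewrite opprD addrACA; apply: nabsD_lt.
  by near: x; exact: fa.
by near: x; exact: gb.
Unshelve. all: by end_near. Qed.

Lemma nabs_cvgM f g a b :
  f @ F --> a -> g @ F --> b -> f x * g x @[x --> F] --> a * b.
Proof.
move=> /nabs_cvgP fa /nabs_cvgP gb; apply/nabs_cvgP => e e0.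
pose c := Num.max (nabs b) 1.
have c0 : 0 < c by rewrite lt_max ltr01 orbT.
pose c' := Num.max (nabs a) 1.
have c'0 : 0 < c' by rewrite lt_max ltr01 orbT.
near=> x.
have -> : a * b - f x * g x =
    (a - f x) * b + (a * (b - g x) + - ((a - f x) * (b - g x))) by ring.
have fx1 : nabs (a - f x) < e / c by near: x; apply: fa; rewrite divr_gt0.
have fx2 : nabs (a - f x) < e by near: x; exact: fa.
have gx1 : nabs (b - g x) < e / c' by near: x; apply: gb; rewrite divr_gt0.
have gx2 : nabs (b - g x) < 1 by near: x; exact: gb.
apply: nabsD_lt; last apply: nabsD_lt.
- rewrite nabsM; apply: (@le_lt_trans _ _ (nabs (a - f x) * c)).
    by rewrite ler_wpM2l ?nabs_ge0// le_max lexx.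
  by rewrite -ltr_pdivlMr.
- rewrite nabsM; apply: (@le_lt_trans _ _ (c' * nabs (b - g x))).
    by rewrite ler_wpM2r ?nabs_ge0// le_max lexx.
  by rewrite mulrC -ltr_pdivlMr.
- rewrite nabsN nabsM; apply: le_lt_trans fx2.
  by rewrite ler_piMr ?nabs_ge0// ltW.
Unshelve. all: by end_near. Qed.

Lemma nabs_cvgN f a : f @ F --> a -> - f x @[x --> F] --> - a.
Proof.
move=> /nabs_cvgP fa; apply/nabs_cvgP => e e0; near=> x.
by rewrite -opprD nabsN; near: x; exact: fa.
Unshelve. all: by end_near. Qed.

Lemma nabs_cvgV f a : a != 0 -> f @ F --> a -> (f x)^-1 @[x --> F] --> a^-1.
Proof.
move=> a0 /nabs_cvgP fa; apply/nabs_cvgP => e e0.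
have na0 : 0 < nabs a by rewrite nabs_gt0.
near=> x.
have fx1 : nabs (a - f x) < nabs a by near: x; exact: fa.
have fx2 : nabs (a - f x) < e * (nabs a * nabs a).
  by near: x; apply: fa; rewrite !mulr_gt0.
have fxa : nabs (f x) = nabs a.
  apply/eqP; rewrite eq_le; apply/andP; split.
    rewrite -[f x](subKr a); apply: le_trans (nabsD _ _) _.
    by rewrite nabsN ge_max lexx ltW.
  rewrite leNgt; apply/negP => fxa.
  by have := nabsD_lt fx1 fxa; rewrite subrK ltxx.
have fx0 : f x != 0 by rewrite -nabs_gt0 fxa.
have -> : a^-1 - (f x)^-1 = - (a - f x) * (a^-1 * (f x)^-1).
  rewrite opprB mulrBl mulrCA mulfV// mulr1.
  by rewrite mulrA mulfV// mul1r.
rewrite nabsM nabsN nabsM !nabsV fxa -invfM -ltr_pdivlMr ?invr_gt0 ?mulr_gt0//.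
by rewrite invrK.
Unshelve. all: by end_near. Qed.

End Limits.

Section MatrixTopology.
Variables m n : nat.
Implicit Types A : 'M[K]_(m, n).

Lemma mx_cvgP T (F : set_system T) (FF : Filter F) (f : T -> 'M[K]_(m, n)) A :
  f @ F --> A <-> forall i j, f x i j @[x --> F] --> A i j.
Proof.
split=> [fA i j P AP|fA P [Q AQ QP]].
  apply: (fA [set B | P (B i j)]).
  exists (fun i' j' => [set x | i' = i -> j' = j -> P x]).
    move=> i' j'; have [ii'|ii'] := eqVneq i' i; last first.
      by apply: filterE => z /eqP; rewrite (negPf ii').
    have [jj'|jj'] := eqVneq j' j; last first.
      by apply: filterE => z _ /eqP; rewrite (negPf jj').
    by rewrite ii' jj'; apply: filterS AP => z Pz.
  by move=> B /(_ i j); exact.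
have : \forall x \near F, forall i j, Q i j (f x i j).
  apply: filter_forall => i; apply: filter_forall => j.
  exact: fA (AQ i j).
by apply: filterS => x Qx; exact: QP.
Qed.

Lemma coord_cont i j : continuous (fun A => A i j).
Proof.
move=> A; have /mx_cvgP : (fun B : 'M[K]_(m, n) => B) @ nbhs A --> A by exact: cvg_id.
exact.
Qed.

Lemma mx_hausdorff : hausdorff_space 'M[K]_(m, n).
Proof.
move=> A B AB; apply/matrixP => i j; apply: nabs_hausdorff => P Q AP BQ.
have [C [PC QC]] := AB _ _ (@coord_cont i j A P AP) (@coord_cont i j B Q BQ).
by exists (C i j).
Qed.

Context {T : Type} {F : set_system T} {FF : Filter F}.
Implicit Types f g : T -> 'M[K]_(m, n).

Lemma mx_cvgD f g A B :
  f @ F --> A -> g @ F --> B -> f x + g x @[x --> F] --> A + B.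
Proof.
move=> /mx_cvgP fA /mx_cvgP gB; apply/mx_cvgP => i j; rewrite mxE.
by under eq_fun do rewrite mxE; exact: nabs_cvgD.
Qed.

Lemma mx_cvgN f A : f @ F --> A -> - f x @[x --> F] --> - A.
Proof.
move=> /mx_cvgP fA; apply/mx_cvgP => i j; rewrite mxE.
by under eq_fun do rewrite mxE; exact: nabs_cvgN.
Qed.

Lemma mx_cvgZ (s : T -> K) f a A :
  s @ F --> a -> f @ F --> A -> s x *: f x @[x --> F] --> a *: A.
Proof.
move=> sa /mx_cvgP fA; apply/mx_cvgP => i j; rewrite mxE.
by under eq_fun do rewrite mxE; exact: nabs_cvgM.
Qed.

End MatrixTopology.

Lemma mx_cvgMr m n p (T : Type) (F : set_system T) {FF : Filter F}
    (f : T -> 'M[K]_(m, n)) (A : 'M[K]_(m, n)) (B : 'M[K]_(n, p)) :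
  f @ F --> A -> (f x *m B) @[x --> F] --> A *m B.
Proof.
move=> /mx_cvgP fA; apply/mx_cvgP => i j; rewrite mxE.
under eq_fun do rewrite mxE.
elim: (index_enum _) => [|k r IH].
  by rewrite big_nil; under eq_fun do rewrite big_nil; exact: cvg_cst.
have -> : (fun x : T => \sum_(l <- k :: r) f x i l * B l j) =
    (fun x : T => f x i k * B k j + \sum_(l <- r) f x i l * B l j).
  by apply/funext => x; rewrite big_cons.
rewrite big_cons.
by apply: nabs_cvgD => //; apply: nabs_cvgM; [exact: fA|exact: cvg_cst].
Qed.

Lemma mulmxr_cont m n p (B : 'M[K]_(n, p)) :
  continuous (fun A : 'M[K]_(m, n) => A *m B).
Proof. by move=> A; exact: (@mx_cvgMr m n p _ (nbhs A) _ id A B (@cvg_id _ _)). Qed.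

Section ContinuityAt.
Variables (X : topologicalType) (x : X).

Lemma mx_contP m n (f : X -> 'M[K]_(m, n)) :
  continuous_at x f <-> forall i j, continuous_at x (fun z => f z i j).
Proof. exact: (@mx_cvgP m n X (nbhs x) _ f (f x)). Qed.

Lemma nabs_contM (f g : X -> K) : continuous_at x f ->
  continuous_at x g -> continuous_at x (fun z => f z * g z).
Proof. exact: (@nabs_cvgM X (nbhs x)). Qed.

Lemma nabs_contV (f : X -> K) : f x != 0 -> continuous_at x f ->
  continuous_at x (fun z => (f z)^-1).
Proof. exact: (@nabs_cvgV X (nbhs x)). Qed.

Lemma mx_contD m n (f g : X -> 'M[K]_(m, n)) : continuous_at x f ->
  continuous_at x g -> continuous_at x (fun z => f z + g z).
Proof. exact: (@mx_cvgD m n X (nbhs x)). Qed.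

Lemma mx_contB m n (f g : X -> 'M[K]_(m, n)) : continuous_at x f ->
  continuous_at x g -> continuous_at x (fun z => f z - g z).
Proof. by move=> cf cg; apply: mx_contD => //; exact: (@mx_cvgN m n X (nbhs x)). Qed.

Lemma mx_contZ m n (s : X -> K) (f : X -> 'M[K]_(m, n)) : continuous_at x s ->
  continuous_at x f -> continuous_at x (fun z => s z *: f z).
Proof. exact: (@mx_cvgZ m n X (nbhs x)). Qed.

Lemma mx_contMr m n p (f : X -> 'M[K]_(m, n)) (B : 'M[K]_(n, p)) :
  continuous_at x f -> continuous_at x (fun z => f z *m B).
Proof. exact: (@mx_cvgMr m n p X (nbhs x)). Qed.

Lemma row_mx_cont l l' (f : X -> 'rV[K]_l) (g : X -> 'rV[K]_l') :
  continuous_at x f -> continuous_at x g ->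
  continuous_at x (fun z => row_mx (f z) (g z)).
Proof.
move=> /mx_contP cf /mx_contP cg; apply/mx_contP => i j.
have -> : (fun z => row_mx (f z) (g z) i j) = (fun z =>
    match fintype.split j with inl k => f z i k | inr k => g z i k end).
  by apply/funext => z; rewrite mxE.
by case: (fintype.split j) => k; [exact: cf|exact: cg].
Qed.

Lemma scalar1_cont (s : X -> K) :
  continuous_at x s -> continuous_at x (fun z => (s z)%:M : 'rV[K]_1).
Proof.
move=> cs; apply/mx_contP => i j.
have -> : (fun z => ((s z)%:M : 'rV[K]_1) i j) = s.
  by apply/funext => z; rewrite !ord1 mxE eqxx.
exact: cs.
Qed.

End ContinuityAt.

Lemma nballP m (y : 'rV[K]_m) (A : set 'rV[K]_m) :
  nbhs y A <-> exists2 e : R, 0 < e & nball y e `<=` A.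
Proof.
split=> [[P yP PA]|[e e0 eA]]; last first.
  exists (fun i j => [set z | nabs (y i j - z) < e]).
    by move=> i j; apply/nabs_nbhsE; exists e.
  by move=> z yz; apply: eA => i; exact: yz.
have /choice[e eP] : forall j, exists e : R, 0 < e /\ [set z | nabs (y 0 j - z) < e] `<=` P 0 j.
  by move=> j; have /nabs_nbhsE[e e0 eP] := yP 0 j; exists e.
exists (\big[Num.min/1]_j e j).
  by apply: lt_bigmin => // j _; exact: (eP j).1.
move=> z yz; apply: PA => i j; rewrite ord1; apply: (eP j).2 => /=.
by apply: lt_le_trans (yz j) _; exact: bigmin_le.
Qed.

Lemma nball_open m (y : 'rV[K]_m) e : open (nball y e).
Proof.
rewrite openE => z yz; apply/nballP; have [e0|e0] := ltP 0 e.
  exists e => // w zw i; have := nabsD_lt (yz i) (zw i).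
  by rewrite addrA subrK.
exists 1 => // w _ i; have := le_lt_trans (nabs_ge0 _) (yz i).
by rewrite ltNge e0.
Qed.

End FieldTopology.

(** * Difference quotients along a mask *)

Section MaskedQuotients.
Variables (R : realType) (K : nonArchFieldType R).

(** The row that encodes the triple (x, v, t). *)
Definition qmk m (x v : 'rV[K]_m) (t : K) : 'rV[K]_(m + m + 1) :=
  row_mx (row_mx x v) t%:M.

Lemma qx_qmk m (x v : 'rV[K]_m) t : qx (qmk x v t) = x.
Proof. by rewrite /qx !row_mxKl. Qed.

Lemma qv_qmk m (x v : 'rV[K]_m) t : qv (qmk x v t) = v.
Proof. by rewrite /qv row_mxKl row_mxKr. Qed.

Lemma qt_qmk m (x v : 'rV[K]_m) t : qt (qmk x v t) = t.
Proof. by rewrite /qt row_mxKr mxE eqxx. Qed.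

Definition qmkE := (qx_qmk, qv_qmk, qt_qmk).

Lemma qmk_q m (p : 'rV[K]_(m + m + 1)) : qmk (qx p) (qv p) (qt p) = p.
Proof.
rewrite /qmk /qx /qv /qt hsubmxK.
have -> : (rsubmx p 0 0)%:M = rsubmx p.
  by apply/matrixP => i j; rewrite !ord1 !mxE eqxx.
exact: hsubmxK.
Qed.

Lemma qP m (p q : 'rV[K]_(m + m + 1)) :
  qx p = qx q -> qv p = qv q -> qt p = qt q -> p = q.
Proof. by move=> ex ev et; rewrite -(qmk_q p) ex ev et qmk_q. Qed.

Definition projx m : 'M[K]_(m + m + 1, m) := col_mx (col_mx 1%:M 0) 0.
Definition projv m : 'M[K]_(m + m + 1, m) := col_mx (col_mx 0 1%:M) 0.
Definition projt m : 'M[K]_(m + m + 1, 1) := col_mx (col_mx 0 0) 1%:M.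

Lemma mul_projx m (p : 'rV[K]_(m + m + 1)) : p *m projx m = qx p.
Proof.
by rewrite -{1}(qmk_q p) /qmk /projx !mul_row_col !mulmx0 !addr0 mulmx1.
Qed.

Lemma mul_projv m (p : 'rV[K]_(m + m + 1)) : p *m projv m = qv p.
Proof.
by rewrite -{1}(qmk_q p) /qmk /projv !mul_row_col !mulmx0 !addr0 add0r mulmx1.
Qed.

Lemma mul_projt m (p : 'rV[K]_(m + m + 1)) : p *m projt m = (qt p)%:M.
Proof.
by rewrite -{1}(qmk_q p) /qmk /projt !mul_row_col !mulmx0 !add0r mulmx1.
Qed.

Lemma qxD m (p q : 'rV[K]_(m + m + 1)) : qx (p + q) = qx p + qx q.
Proof. by rewrite -!mul_projx mulmxDl. Qed.

Lemma qvD m (p q : 'rV[K]_(m + m + 1)) : qv (p + q) = qv p + qv q.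
Proof. by rewrite -!mul_projv mulmxDl. Qed.

Lemma qtD m (p q : 'rV[K]_(m + m + 1)) : qt (p + q) = qt p + qt q.
Proof. by rewrite /qt !mxE. Qed.

Lemma qxZ m s (p : 'rV[K]_(m + m + 1)) : qx (s *: p) = s *: qx p.
Proof. by rewrite -!mul_projx scalemxAl. Qed.

Lemma qvZ m s (p : 'rV[K]_(m + m + 1)) : qv (s *: p) = s *: qv p.
Proof. by rewrite -!mul_projv scalemxAl. Qed.

Lemma qtZ m s (p : 'rV[K]_(m + m + 1)) : qt (s *: p) = s * qt p.
Proof. by rewrite /qt !mxE. Qed.

Lemma qx_cont m : continuous (@qx R K m).
Proof.
have -> : @qx R K m = (fun p => p *m projx m).
  by apply/funext => p; rewrite mul_projx.
by move=> p; exact: mulmxr_cont.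
Qed.

Lemma qv_cont m : continuous (@qv R K m).
Proof.
have -> : @qv R K m = (fun p => p *m projv m).
  by apply/funext => p; rewrite mul_projv.
by move=> p; exact: mulmxr_cont.
Qed.

Lemma qt_cont m : continuous (@qt R K m).
Proof.
have -> : @qt R K m = (fun p => p 0 (rshift (m + m) 0)).
  by apply/funext => p; rewrite /qt mxE.
by move=> p; exact: coord_cont.
Qed.

(** The mask [Pi] projects onto the directions in which difference quotients are
    taken. *)
Definition endpoint m (Pi : 'M[K]_m) p : 'rV[K]_m := qx p + qt p *: (qv p *m Pi).

Definition mdom m (Pi : 'M[K]_m) (U : set 'rV[K]_m) : set 'rV[K]_(m + m + 1) :=
  [set p | U (qx p) /\ U (endpoint Pi p)].

(** Written without division, so that the condition is trivial for t = 0: there,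
    the value of [g] is prescribed by continuity. *)
Definition is_mquot m l (Pi : 'M[K]_m) (U : set 'rV[K]_m)
    (f : 'rV[K]_m -> 'rV[K]_l) g :=
  forall p, mdom Pi U p -> qt p *: g p = f (endpoint Pi p) - f (qx p).

(** The mask for the variables (x, v, t) of a difference quotient: x keeps its
    mask, all of v becomes active, and t is active exactly when [b] holds. *)
Definition next_mask (b : bool) m (Pi : 'M[K]_m) : 'M[K]_(m + m + 1) :=
  block_mx (block_mx Pi 0 0 1%:M) 0 0 (b%:R)%:M.

Definition cont_on (X Y : topologicalType) (U : set X) (f : X -> Y) :=
  forall x, U x -> {for x, continuous f}.

(** On an open set and for the identity mask, this is the class C^[n] if [b] is
    true and the class C^n if [b] is false. *)
Fixpoint mclass l (b : bool) (n : nat) (m : nat) (Pi : 'M[K]_m)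
    (U : set 'rV[K]_m) (f : 'rV[K]_m -> 'rV[K]_l) {struct n} : Prop :=
  cont_on U f /\
  if n is n'.+1 then
    exists g, is_mquot Pi U f g /\ mclass b n' (next_mask b Pi) (mdom Pi U) g
  else True.

Lemma mulmx_next_mask b m (Pi : 'M[K]_m) p :
  p *m next_mask b Pi = qmk (qx p *m Pi) (qv p) (b%:R * qt p).
Proof.
rewrite -{1}(qmk_q p) /qmk /next_mask !mul_row_block !mulmx0 !addr0 !add0r mulmx1.
by rewrite -scalar_mxM mulrC.
Qed.

Lemma endpoint_next b m (Pi : 'M[K]_m) p : endpoint (next_mask b Pi) p =
  qmk (qx (qx p) + qt p *: (qx (qv p) *m Pi)) (qv (qx p) + qt p *: qv (qv p))
     (qt (qx p) + qt p * (b%:R * qt (qv p))).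
Proof.
rewrite /endpoint mulmx_next_mask; apply: qP; rewrite ?qxD ?qvD ?qtD ?qxZ ?qvZ ?qtZ.
- by rewrite !qmkE.
- by rewrite !qmkE.
- by rewrite !qmkE.
Qed.

Lemma next_mask_idem b m (Pi : 'M[K]_m) : Pi *m Pi = Pi ->
  next_mask b Pi *m next_mask b Pi = next_mask b Pi.
Proof.
move=> Pi2; rewrite /next_mask !mulmx_block !mulmx0 !mul0mx !addr0 !add0r Pi2 mulmx1.
by rewrite -scalar_mxM -natrM mulnb andbb.
Qed.

Lemma next_mask1 m : next_mask true (1%:M : 'M[K]_m) = 1%:M.
Proof. by rewrite /next_mask -!scalar_mx_block. Qed.

Lemma endpoint_cont m (Pi : 'M[K]_m) : continuous (endpoint Pi).
Proof.
move=> p; apply: mx_contD; first exact: qx_cont.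
apply: mx_contZ; first exact: qt_cont.
by apply: mx_contMr; exact: qv_cont.
Qed.

Lemma mdom_open m (Pi : 'M[K]_m) U : open U -> open (mdom Pi U).
Proof.
move=> oU; apply: openI; apply: open_comp => // p _.
  exact: qx_cont.
exact: endpoint_cont.
Qed.

Lemma qmk_cont (X : topologicalType) z m (x v : X -> 'rV[K]_m) t :
  continuous_at z x -> continuous_at z v -> continuous_at z t ->
  continuous_at z (fun u => qmk (x u) (v u) (t u)).
Proof.
move=> cx cv ct; apply: row_mx_cont; first exact: row_mx_cont.
exact: scalar1_cont.
Qed.

Lemma qmk_step_cont m (x v : 'rV[K]_m) : continuous (qmk x v).
Proof. by move=> t; apply: qmk_cont; [exact: cvg_cst|exact: cvg_cst|exact: cvg_id]. Qed.

Lemma cont_on_eq (X Y : topologicalType) (U : set X) (f g : X -> Y) : open U ->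
  {in U, f =1 g} -> cont_on U f -> cont_on U g.
Proof.
move=> oU fg cf x Ux; rewrite /prop_for /continuous_at -(fg x (mem_set Ux)).
apply: cvg_trans (cf x Ux); apply: near_eq_cvg.
apply: filterS (open_nbhs_nbhs (conj oU Ux)) => z Uz.
by rewrite fg//; exact: mem_set.
Qed.

Lemma cont_on_comp (X Y Z : topologicalType) (U : set X) (V : set Y)
    (f : Y -> Z) (g : X -> Y) : cont_on V f -> cont_on U g ->
  (forall x, U x -> V (g x)) -> cont_on U (f \o g).
Proof.
move=> cf cg gUV x Ux; apply: continuous_comp; first exact: cg.
exact/cf/gUV.
Qed.

(** Points are not isolated in K and matrices form a Hausdorff space.  This is
    how identities between difference quotients pass to vanishing steps. *)
Lemma punctured_eq m n (F G : K -> 'M[K]_(m, n)) a :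
  {for a, continuous F} -> {for a, continuous G} ->
  (\forall e \near a, e != a -> F e = G e) -> F a = G a.
Proof.
move=> cF cG FG; apply: (@mx_hausdorff R K) => P Q FP GQ.
have FP' : \forall e \near a, P (F e) by exact: cF.
have GQ' : \forall e \near a, Q (G e) by exact: cG.
have [b ba [[/= Pb Qb] FGb]] := nbhs_punctured (filterI (filterI FP' GQ') FG).
by exists (F b); split => //; rewrite FGb.
Qed.

(** At a point with t = 0 the value is the limit of the values at (x, v, e) for
    e <> 0, which are determined by f. *)
Lemma mquot_unique m l (Pi : 'M[K]_m) U (f : _ -> 'rV[K]_l) g g' : open U ->
  is_mquot Pi U f g -> is_mquot Pi U f g' ->
  cont_on (mdom Pi U) g -> cont_on (mdom Pi U) g' ->
  forall p, mdom Pi U p -> g p = g' p.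
Proof.
move=> oU fg fg' cg cg' p Up.
have [t0|t0] := eqVneq (qt p) 0; last first.
  by apply: (scalerI t0); rewrite fg// fg'.
have e0 h : h p = h (qmk (qx p) (qv p) 0) :> 'rV[K]_l by rewrite -t0 qmk_q.
have Up0 : mdom Pi U (qmk (qx p) (qv p) 0) by rewrite -t0 qmk_q.
rewrite (e0 g) (e0 g'); apply: (@punctured_eq _ _ (g \o qmk _ _) (g' \o qmk _ _)).
- by apply: continuous_comp; [exact: qmk_step_cont|exact: cg].
- by apply: continuous_comp; [exact: qmk_step_cont|exact: cg'].
have nU : \forall e \near (0 : K), mdom Pi U (qmk (qx p) (qv p) e).
  apply: (@qmk_step_cont _ (qx p) (qv p) 0 (mdom Pi U)).
  by apply: open_nbhs_nbhs; split => //; exact: mdom_open.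
apply: filterS nU => e Ue ne0 /=; apply: (scalerI ne0).
have := fg _ Ue; have := fg' _ Ue.
by rewrite !qt_qmk => -> ->.
Qed.

Lemma mclass_cont l b n m (Pi : 'M[K]_m) U (f : _ -> 'rV[K]_l) :
  mclass b n Pi U f -> cont_on U f.
Proof. by case: n => [|n] []. Qed.

Lemma mclass_eq l b n m (Pi : 'M[K]_m) U (f f' : _ -> 'rV[K]_l) : open U ->
  {in U, f =1 f'} -> mclass b n Pi U f -> mclass b n Pi U f'.
Proof.
move=> oU ff'; case: n => [|n] [cf]; first by split => //; exact: cont_on_eq cf.
move=> [g [fg gn]]; split; first exact: cont_on_eq cf.
exists g; split => // p [Up Up']; rewrite -!ff' ?inE//.
exact: fg.
Qed.

Lemma mclassW l b n m (Pi : 'M[K]_m) U (f : _ -> 'rV[K]_l) :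
  mclass b n.+1 Pi U f -> mclass b n Pi U f.
Proof.
elim: n m Pi U f => [|n IH] m Pi U f [cf]; first by [].
by move=> [g [fg gn]]; split => //; exists g; split => //; exact: IH.
Qed.

(** A linear substitution L acts on the variables (x, v, t) of the quotient as
    diag(L, L, 1). *)
Lemma mclass_prelin l b n m m' (Pi : 'M[K]_m) (Pi' : 'M[K]_m') (L : 'M[K]_(m, m'))
    U U' (f : _ -> 'rV[K]_l) :
  Pi *m L = L *m Pi' -> (forall x, U x -> U' (x *m L)) ->
  mclass b n Pi' U' f -> mclass b n Pi U (fun x => f (x *m L)).
Proof.
elim: n m m' Pi Pi' L U U' f => [|n IH] m m' Pi Pi' L U U' f PiL UU' [cf].
  move=> _; split => //; apply: cont_on_comp cf _ UU' => x _.
  exact: mulmxr_cont.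
have cfL : cont_on U (fun x => f (x *m L)).
  apply: cont_on_comp cf _ UU' => x _.
  exact: mulmxr_cont.
move=> [g [fg gn]]; split => //.
pose L' : 'M[K]_(m + m + 1, m' + m' + 1) := block_mx (block_mx L 0 0 L) 0 0 1%:M.
have L'E p : p *m L' = qmk (qx p *m L) (qv p *m L) (qt p).
  rewrite -{1}(qmk_q p) /qmk /L' !mul_row_block !mulmx0 !addr0 !add0r.
  by rewrite mulmx1.
have shL p : endpoint Pi' (p *m L') = endpoint Pi p *m L.
  by rewrite /endpoint L'E !qmkE mulmxDl -scalemxAl -!mulmxA PiL.
have dL p : mdom Pi U p -> mdom Pi' U' (p *m L').
  by move=> [Up Up']; split; rewrite ?shL ?L'E ?qmkE; exact: UU'.
exists (fun p => g (p *m L')); split.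
  move=> p Up; have := fg _ (dL _ Up).
  by rewrite shL {1}L'E !qmkE L'E !qmkE => ->.
apply: IH gn => //.
rewrite /L' /next_mask !mulmx_block !mulmx0 !mul0mx !addr0 !add0r PiL.
by rewrite mulmx1 mul1mx mulmx1 mul1mx.
Qed.

Lemma mclass_sub l b n m (Pi : 'M[K]_m) U V (f : _ -> 'rV[K]_l) :
  V `<=` U -> mclass b n Pi U f -> mclass b n Pi V f.
Proof.
move=> VU fn; have := @mclass_prelin l b n m m Pi Pi 1%:M V U f.
rewrite mulmx1 mul1mx => /(_ erefl) H.
have -> : f = (fun x => f (x *m 1%:M)) by apply/funext => x; rewrite mulmx1.
by apply: H => // x Vx; rewrite mulmx1; exact: VU.
Qed.

Lemma mclass_qx l b n m (Pi : 'M[K]_m) U V (f : _ -> 'rV[K]_l) :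
  (forall p, V p -> U (qx p)) ->
  mclass b n Pi U f -> mclass b n (next_mask b Pi) V (f \o @qx R K m).
Proof.
move=> VU fn; have -> : f \o @qx R K m = (fun p => f (p *m projx m)).
  by apply/funext => p; rewrite mul_projx.
apply: mclass_prelin fn => [|p Vp]; last by rewrite mul_projx; exact: VU.
rewrite /projx /next_mask mul_block_col mul_block_col !mulmx0 !mul0mx !addr0 mulmx1.
by rewrite !mul_col_mx mul1mx !mul0mx.
Qed.

Lemma mclass_cst l b n m (Pi : 'M[K]_m) U (c : 'rV[K]_l) :
  mclass b n Pi U (fun=> c).
Proof.
have ccst m' (V : set 'rV[K]_m') d : cont_on V (fun=> d : 'rV[K]_l).
  by move=> x _; exact: cst_continuous.
elim: n m Pi U c => [|n IH] m Pi U c; split => //.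
by exists (fun=> 0); split => // p _; rewrite scaler0 subrr.
Qed.

Lemma mclass_lin l b n m (Pi : 'M[K]_m) U (L : 'M[K]_(m, l)) :
  mclass b n Pi U (fun x => x *m L).
Proof.
have cL m' (V : set 'rV[K]_m') (B : 'M[K]_(m', l)) : cont_on V (fun x => x *m B).
  by move=> x _; apply: mx_contMr; exact: cvg_id.
elim: n m Pi U L => [|n IH] m Pi U L; split => //.
exists (fun p => p *m (projv m *m (Pi *m L))); split => // p _.
by rewrite !mulmxA mul_projv /endpoint mulmxDl addrAC subrr add0r scalemxAl.
Qed.

Lemma mclassD l b n m (Pi : 'M[K]_m) U (f f' : _ -> 'rV[K]_l) :
  mclass b n Pi U f -> mclass b n Pi U f' -> mclass b n Pi U (fun x => f x + f' x).
Proof.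
elim: n m Pi U f f' => [|n IH] m Pi U f f' [cf fn] [cf' fn'].
  by split => // x Ux; apply: mx_contD; [exact: cf|exact: cf'].
split; first by move=> x Ux; apply: mx_contD; [exact: cf|exact: cf'].
move: fn fn' => [g [fg gn]] [g' [fg' gn']].
exists (fun x => g x + g' x); split; last exact: IH.
by move=> p Up; rewrite scalerDr fg// fg'// opprD addrACA.
Qed.

Lemma mclass_scale l b n m (Pi : 'M[K]_m) U (c : K) (f : _ -> 'rV[K]_l) :
  mclass b n Pi U f -> mclass b n Pi U (fun x => c *: f x).
Proof.
have cZ m' (V : set 'rV[K]_m') (h : _ -> 'rV[K]_l) :
    cont_on V h -> cont_on V (fun x => c *: h x).
  by move=> ch x Vx; apply: mx_contZ; [exact: cst_continuous|exact: ch].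
elim: n m Pi U f => [|n IH] m Pi U f [cf fn]; split => //; try exact: cZ.
move: fn => [g [fg gn]]; exists (fun x => c *: g x); split; last exact: IH.
by move=> p Up; rewrite scalerA mulrC -scalerA fg// scalerBr.
Qed.

Lemma mclass_row l l' b n m (Pi : 'M[K]_m) U (f : _ -> 'rV[K]_l) (f' : _ -> 'rV[K]_l') :
  mclass b n Pi U f -> mclass b n Pi U f' ->
  mclass b n Pi U (fun x => row_mx (f x) (f' x)).
Proof.
elim: n m Pi U f f' => [|n IH] m Pi U f f' [cf fn] [cf' fn'].
  by split => // x Ux; apply: row_mx_cont; [exact: cf|exact: cf'].
split; first by move=> x Ux; apply: row_mx_cont; [exact: cf|exact: cf'].
move: fn fn' => [g [fg gn]] [g' [fg' gn']].
exists (fun x => row_mx (g x) (g' x)); split; last exact: IH.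
by move=> p Up; rewrite scale_row_mx fg// fg'// opp_row_mx add_row_mx.
Qed.

Lemma mclass_qt b n m (Pi : 'M[K]_(m + m + 1)) U :
  mclass b n Pi U (fun p => (qt p)%:M : 'rV[K]_1).
Proof.
by under eq_fun do rewrite -mul_projt; exact: mclass_lin.
Qed.

(** Product rule:
    (s f)^[1] = s^[1] f(x) + s(x) f^[1] + t s^[1] f^[1]. *)
Lemma mclassZ l b n m (Pi : 'M[K]_m) U (s : _ -> 'rV[K]_1) (f : _ -> 'rV[K]_l) :
  mclass b n Pi U s -> mclass b n Pi U f ->
  mclass b n Pi U (fun x => s x 0 0 *: f x).
Proof.
elim: n m l Pi U s f => [|n IH] m l Pi U s f [cs sn] [cf fn].
  split => // x Ux; apply: mx_contZ; last exact: cf.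
  by have /mx_contP := cs x Ux; apply.
split.
  move=> x Ux; apply: mx_contZ; last exact: cf.
  by have /mx_contP := cs x Ux; apply.
move: (sn) (fn) => [s1 [s1P s1n]] [f1 [f1P f1n]].
exists (fun p => s1 p 0 0 *: f (qx p) + (s (qx p) 0 0 *: f1 p +
  (qt p *: s1 p) 0 0 *: f1 p)); split.
  move=> p Up; have f1E := f1P p Up.
  have s1E : s (endpoint Pi p) 0 0 = s (qx p) 0 0 + qt p * s1 p 0 0.
    have /matrixP/(_ 0 0) := s1P p Up; rewrite !mxE => ->; ring.
  have -> : f (endpoint Pi p) = f (qx p) + qt p *: f1 p.
    by rewrite f1E [RHS]addrC subrK.
  rewrite s1E !mxE; apply/rowP => j; rewrite !mxE; ring.
have sn' : mclass b n Pi U s by apply: mclassW; split.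
have fn' : mclass b n Pi U f by apply: mclassW; split.
apply: mclassD.
  by apply: (IH _ _ _ _ s1 (f \o @qx R K m)) => //; apply: mclass_qx fn' => p [].
apply: mclassD.
  by apply: (IH _ _ _ _ (s \o @qx R K m) f1) => //; apply: mclass_qx sn' => p [].
apply: (IH _ _ _ _ (fun p => qt p *: s1 p) f1) => //.
have -> : (fun p => qt p *: s1 p) = (fun p => ((qt p)%:M : 'rV[K]_1) 0 0 *: s1 p).
  by apply/funext => p; rewrite mxE eqxx.
by apply: (IH _ _ _ _ (fun p => (qt p)%:M) s1) => //; exact: mclass_qt.
Qed.

End MaskedQuotients.

(** * Inverses, chain rule and locality *)

Section MaskedChainRule.
Variables (R : realType) (K : nonArchFieldType R).

(** (1 / s)^[1] = - s^[1] / (s(x) (s(x) + t s^[1])), where the last factor is the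
    value of s at the endpoint. *)
Lemma mclassV b n m (Pi : 'M[K]_m) U (s : _ -> 'rV[K]_1) :
  (forall x, U x -> s x 0 0 != 0) -> mclass b n Pi U s ->
  mclass b n Pi U (fun x => (s x 0 0)^-1%:M : 'rV[K]_1).
Proof.
have cV m' (V : set 'rV[K]_m') (s' : _ -> 'rV[K]_1) :
    (forall x, V x -> s' x 0 0 != 0) -> cont_on V s' ->
    cont_on V (fun x => (s' x 0 0)^-1%:M : 'rV[K]_1).
  move=> s'0 cs' x Vx; apply: scalar1_cont.
  apply: nabs_contV; first exact: s'0.
  by have /mx_contP := cs' x Vx; apply.
elim: n m Pi U s => [|n IH] m Pi U s s0 [cs sn]; split => //; try exact: cV.
have sn' : mclass b n Pi U s by apply: mclassW; split.
move: sn => [s1 [s1P s1n]].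
have s1E p : mdom Pi U p -> s (endpoint Pi p) 0 0 = s (qx p) 0 0 + qt p * s1 p 0 0.
  by move=> Up; have /matrixP/(_ 0 0) := s1P p Up; rewrite !mxE => ->; ring.
pose s2 p : 'rV[K]_1 := s (qx p) + ((qt p)%:M : 'rV[K]_1) 0 0 *: s1 p.
have s2E p : mdom Pi U p -> s2 p 0 0 = s (endpoint Pi p) 0 0.
  by move=> Up; rewrite s1E// /s2 !mxE eqxx.
have sqx : mclass b n (next_mask b Pi) (mdom Pi U) (s \o @qx R K m).
  by apply: mclass_qx sn' => p [].
exists (fun p => ((-1) *: ((s (qx p) 0 0)^-1%:M : 'rV[K]_1)) 0 0 *:
   ((((s2 p 0 0)^-1%:M : 'rV[K]_1)) 0 0 *: s1 p)); split.
  move=> p Up; rewrite s2E//; have [Ux Us] := Up.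
  have a0 := s0 _ Ux; have b0 := s0 _ Us.
  have {}s1E : qt p * s1 p 0 0 = s (endpoint Pi p) 0 0 - s (qx p) 0 0.
    by rewrite s1E//; ring.
  apply/rowP => j; rewrite !ord1 !mxE eqxx !mulr1n.
  rewrite mulrCA [qt p * _]mulrCA s1E; field.
  by rewrite a0 b0.
apply: (@mclassZ _ _ _ _ _ _ _ _ (fun p => (-1) *: ((s (qx p) 0 0)^-1%:M : 'rV[K]_1))).
  apply/mclass_scale/(IH _ _ _ (s \o @qx R K m)) => //.
  by move=> p [Up _]; exact: s0.
apply: (@mclassZ _ _ _ _ _ _ _ _ (fun p => (s2 p 0 0)^-1%:M : 'rV[K]_1)) => //.
apply: IH.
  by move=> p Up; rewrite s2E//; apply: s0; case: Up.
apply: (@mclassD _ _ _ _ _ _ _ _ (s \o @qx R K m)) => //.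
apply: (@mclassZ _ _ _ _ _ _ _ _ (fun p => (qt p)%:M)) => //.
exact: mclass_qt.
Qed.

Lemma mclass_sum l I (rs : seq I) (P : pred I) b q m (Pi : 'M[K]_m) D
    (F : I -> 'rV[K]_m -> 'rV[K]_l) :
  (forall i, P i -> mclass b q Pi D (F i)) ->
  mclass b q Pi D (fun z => \sum_(i <- rs | P i) F i z).
Proof.
move=> cF; elim: rs => [|i rs IH].
  have -> : (fun z => \sum_(i <- [::] | P i) F i z) = (fun=> 0).
    by apply/funext => z; rewrite big_nil.
  exact: mclass_cst.
have -> : (fun z => \sum_(j <- i :: rs | P j) F j z) = (fun z =>
    (if P i then F i z else 0) + \sum_(j <- rs | P j) F j z).
  by apply/funext => z; rewrite big_cons; case: ifP => // _; rewrite add0r.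
apply: mclassD => //; have [Pi'|_] := boolP (P i); first exact: cF.
exact: mclass_cst.
Qed.

(** Along the directions of [Pi], the map [g] only moves in those of [Pi']. *)
Definition respects m m' (Pi : 'M[K]_m) (Pi' : 'M[K]_m') W (g : _ -> 'rV[K]_m') :=
  forall p, mdom Pi W p ->
    (g (endpoint Pi p) - g (qx p)) *m Pi' = g (endpoint Pi p) - g (qx p).

(** (f o g)^[1] = f^[1] o (g, g^[1], t).  As [g] respects the masks, multiplying
    g^[1] by the target mask does not change t g^[1], so that the endpoint of
    (g, g^[1], t) is g at the endpoint. *)
Lemma mclass_comp l b n m m' (Pi : 'M[K]_m) (Pi' : 'M[K]_m') W U
    (f : _ -> 'rV[K]_l) g :
  respects Pi Pi' W g -> (forall x, W x -> U (g x)) ->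
  mclass b n Pi' U f -> mclass b n Pi W g -> mclass b n Pi W (f \o g).
Proof.
elim: n m m' Pi Pi' W U f g => [|n IH] m m' Pi Pi' W U f g gPi WU [cf fn] gn.
  by split => //; exact: cont_on_comp cf (mclass_cont gn) WU.
split; first exact: cont_on_comp cf (mclass_cont gn) WU.
have gn' := mclassW gn; move: gn fn => [cg [g1 [g1P g1n]]] [f1 [f1P f1n]].
pose G p := qmk (g (qx p)) (g1 p) (qt p).
have shG p : mdom Pi W p -> endpoint Pi' (G p) = g (endpoint Pi p).
  move=> Wp; rewrite /endpoint !qmkE scalemxAl g1P// gPi//.
  by rewrite [RHS](_ : _ = g (endpoint Pi p))// addrC subrK.
have GU p : mdom Pi W p -> mdom Pi' U (G p).
  by move=> Wp; have [Wx Ws] := Wp; split; rewrite ?shG// ?qmkE; exact: WU.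
exists (f1 \o G); split.
  move=> p Wp; have := f1P _ (GU p Wp).
  by rewrite shG// {1 3}/G !qmkE.
apply: IH f1n _ => //.
  move=> q Wq; rewrite mulmx_next_mask; have [Wq1 Wq2] := Wq.
  have H : mdom Pi W (qmk (qx (qx q)) (qx (qv q)) (qt q)).
    split; rewrite ?qmkE; first by case: Wq1.
    by move: Wq2 => []; rewrite endpoint_next qmkE /endpoint !qmkE.
  have e : qx (endpoint (next_mask b Pi) q) = endpoint Pi (qmk (qx (qx q)) (qx (qv q)) (qt q)).
    by rewrite endpoint_next /endpoint !qmkE.
  apply: qP; rewrite !qmkE.
  - have := gPi _ H.
    by rewrite -e qmkE -[- G _]scaleN1r qxD qxZ !qmkE scaleN1r.
  - by [].
  - rewrite -[- G _]scaleN1r qtD qtZ !qmkE endpoint_next !qmkE.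
    have : b%:R * b%:R = b%:R :> K by rewrite -natrM mulnb andbb.
    set c := b%:R => c2.
    have -> : qt (qx q) + qt q * (c * qt (qv q)) + -1 * qt (qx q) =
      qt q * (c * qt (qv q)) by ring.
    by rewrite mulrCA (mulrA c) c2.
apply: mclass_row; last exact: mclass_qt.
apply: mclass_row => //.
by apply: (@mclass_qx _ _ _ _ _ _ _ W) => // p [].
Qed.

(** The local quotients agree on the overlap of their domains by uniqueness, which
    settles the points with t = 0.  Near a point with t <> 0 the quotient is
    t^-1 (f(x + t v) - f(x)), where the two values of f are taken in different
    members of the covering: it is in the class by the rules for products,
    inverses and compositions. *)
Lemma mclass_local l b n m (Pi : 'M[K]_m) U (f : _ -> 'rV[K]_l) :
  Pi *m Pi = Pi -> open U ->
  (forall x, U x -> exists N, [/\ open N, N x & mclass b n Pi N f]) ->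
  mclass b n Pi U f.
Proof.
elim: n m Pi U f => [|n IH] m Pi U f Pi2 oU locf.
  by split=> // x /locf[N [_ Nx [cf _]]]; exact: cf.
split; first by move=> x /locf[N [_ Nx [cf _]]]; exact: cf.
have /choice[N NP] : forall x, exists N : set 'rV[K]_m,
    U x -> [/\ open N, N x & mclass b n.+1 Pi N f].
  move=> x; have [/locf[N NP]|Ux] := pselect (U x); first by exists N.
  by exists setT.
have /choice[g gP] : forall x, exists g, U x -> is_mquot Pi (N x) f g /\
    mclass b n (next_mask b Pi) (mdom Pi (N x)) g.
  move=> x; have [/NP[_ _ [_ [g gP]]]|Ux] := pselect (U x); first by exists g.
  by exists (fun=> 0).
pose G p := if qt p == 0 then g (qx p) p
  else (qt p)^-1 *: (f (endpoint Pi p) - f (qx p)).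
exists G; split.
  move=> p [Ux Us]; rewrite /G; case: eqVneq => [t0|t0].
    by rewrite t0 scale0r /endpoint t0 scale0r addr0 subrr.
  by rewrite scalerA mulfV// scale1r.
apply: IH; [exact: next_mask_idem|exact: mdom_open|move=> p [Ux Us]].
have [t0|t0] := eqVneq (qt p) 0.
  have [oN Nx _] := NP _ Ux; have [gP1 gP2] := gP _ Ux.
  exists (mdom Pi (N (qx p)) `&` mdom Pi U); split.
  - by apply: openI; exact: mdom_open.
  - by split; split => //; rewrite /endpoint t0 scale0r addr0.
  apply: (@mclass_eq _ _ _ _ _ _ _ _ (g (qx p))).
  - by apply: openI; exact: mdom_open.
  - move=> q /set_mem[Nq Uq]; rewrite /G; case: eqVneq => [q0|q0].
      have [oN' Nx' _] := NP _ (proj1 Uq); have [gP1' gP2'] := gP _ (proj1 Uq).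
      apply: (@mquot_unique _ _ _ _ Pi (N (qx p) `&` N (qx q)) f).
      + exact: openI.
      + by move=> r [[? _] [? _]]; exact: gP1.
      + by move=> r [[_ ?] [_ ?]]; exact: gP1'.
      + by move=> r [[? _] [? _]]; exact: (mclass_cont gP2).
      + by move=> r [[_ ?] [_ ?]]; exact: (mclass_cont gP2').
      + have Nqs : N (qx q) (endpoint Pi q) by rewrite /endpoint q0 scale0r addr0.
        by case: Nq => ? ?; split; split.
    by apply: (scalerI q0); rewrite gP1// scalerA mulfV// scale1r.
  by apply: mclass_sub gP2 => q [].
have [oN Nx Nf] := NP _ Ux; have [oN' Ns Nf'] := NP _ Us.
pose V := (@qx R K m) @^-1` N (qx p) `&` (endpoint Pi) @^-1` N (endpoint Pi p) `&`
          [set q : 'rV[K]_(m + m + 1) | qt q != 0].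
have oV : open V.
  apply: openI; first apply: openI.
  - by apply: open_comp => // q _; exact: qx_cont.
  - by apply: open_comp => // q _; exact: endpoint_cont.
  - have -> : [set q : 'rV[K]_(m + m + 1) | qt q != 0] = @qt R K m @^-1` (~` [set 0]).
      by apply/seteqP; split => q /=; move/eqP.
    apply: open_comp => [q _|]; first exact: qt_cont.
    apply: closed_openC; apply: accessible_closed_set1.
    exact/hausdorff_accessible/nabs_hausdorff.
exists V; split => //.
apply: (@mclass_eq _ _ _ _ _ _ _ _
  (fun q => (((((qt q)%:M : 'rV[K]_1) 0 0)^-1)%:M : 'rV[K]_1) 0 0 *:
    (f (endpoint Pi q) + (-1) *: f (qx q)))) => //.
  move=> q /set_mem[_ /= /negbTE q0].
  by rewrite /G q0 !mxE eqxx scaleN1r.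
apply: (@mclassZ _ _ _ _ _ _ _ _ (fun q => (((qt q)%:M : 'rV[K]_1) 0 0)^-1%:M)).
  have := @mclassV b n _ (next_mask b Pi) V (fun q => (qt q)%:M).
  apply; last exact: mclass_qt.
  by move=> q [_ q0]; rewrite mxE eqxx.
apply: mclassD.
  apply: (@mclass_comp _ _ _ _ _ _ Pi _ (N (endpoint Pi p))); last first.
  - have -> : endpoint Pi = (fun q => q *m projx K m +
        ((qt q)%:M : 'rV[K]_1) 0 0 *: (q *m (projv K m *m Pi))).
      apply/funext => q.
      by rewrite mul_projx mulmxA mul_projv !mxE eqxx.
    apply: mclassD; first exact: mclass_lin.
    apply: (@mclassZ _ _ _ _ _ _ _ _ (fun q => (qt q)%:M)); first exact: mclass_qt.
    exact: mclass_lin.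
  - exact: mclassW.
  - by move=> q [[_]].
  - move=> q _; rewrite endpoint_next /endpoint !qmkE.
    set X' := qx (qv q); set T := qt (qx q) + _; set W := qv (qx q) + _.
    suff -> : qx (qx q) + qt q *: (X' *m Pi) + T *: (W *m Pi) -
        (qx (qx q) + qt (qx q) *: (qv (qx q) *m Pi)) =
        (qt q *: X' + T *: W - qt (qx q) *: qv (qx q)) *m Pi.
      by rewrite -mulmxA Pi2.
    clearbody W; rewrite mulmxBl mulmxDl -!scalemxAl.
    by rewrite opprD addrACA addrA [qx (qx q) + _]addrC addrK.
apply: mclass_scale; apply: (@mclass_qx _ _ _ _ _ _ _ (N (qx p))) (mclassW Nf).
by move=> q [[]].
Qed.

End MaskedChainRule.

(** * The classes of iterated quotients in all variables *)

Section BracketClass.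
Variables (R : realType) (K : nonArchFieldType R).

Lemma within_contP (X Y : topologicalType) (U : set X) (f : X -> Y) : open U ->
  {within U, continuous f} <-> cont_on U f.
Proof.
move=> oU; rewrite continuous_open_subspace//; split=> cf x Ux.
  by apply: cf; exact: mem_set.
by apply: cf; exact: set_mem.
Qed.

Lemma mdom1 m (U : set 'rV[K]_m) : mdom 1%:M U = qdom U.
Proof. by apply/seteqP; split => p; rewrite /mdom /qdom /= /endpoint mulmx1. Qed.

Lemma quot_extP m l (U : set 'rV[K]_m) (f : _ -> 'rV[K]_l) g : open U ->
  is_cont_ext (qdom U) [set p | qt p != 0] (quot f) g <->
  cont_on (mdom 1%:M U) g /\ is_mquot 1%:M U f g.
Proof.
move=> oU; rewrite -mdom1 /is_cont_ext within_contP; last exact: mdom_open.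
split=> [[cg gq]|[cg gq]]; split => // p.
  move=> Up; have [t0|t0] := eqVneq (qt p) 0.
    by rewrite t0 scale0r /endpoint t0 scale0r addr0 subrr.
  by rewrite gq// /quot scalerA mulfV// scale1r /endpoint mulmx1.
move=> Up t0; apply: (scalerI t0); rewrite gq//.
by rewrite /quot scalerA mulfV// scale1r /endpoint mulmx1.
Qed.

Lemma brdom_open m (U : set 'rV[K]_m) k : open U -> open (brdom U k).
Proof. by move=> oU; elim: k => //= k IH; rewrite -mdom1; exact: mdom_open. Qed.

(** [Upsilon] makes a choice of the extension at each stage, which by uniqueness
    is the one provided by [mclass]. *)
Lemma br_classP m l (U : set 'rV[K]_m) (f : _ -> 'rV[K]_l) n : open U ->
  br_class U f n <-> mclass true n 1%:M U f.
Proof.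
move=> oU; have oD k := @brdom_open m U k oU.
pose ext k := is_cont_ext (brdom U k.+1) [set p | qt p != 0] (quot (Upsilon U f k)).
have extU k : (exists g, ext k g) -> ext k (Upsilon U f k.+1).
  by move=> exg; exact: (xgetPex _ exg).
split=> [[/within_contP cf fn]|fn].
  have cU k : (k <= n)%N -> cont_on (brdom U k) (Upsilon U f k).
    case: k => [_|k kn]; first exact: cf.
    by have [] := (quot_extP _ _ (oD k)).1 (extU k (fn k kn)); rewrite mdom1.
  suff H j i : (i + j = n)%N -> mclass true j 1%:M (brdom U i) (Upsilon U f i).
    exact: (H n 0%N).
  elim: j i => [|j IH] i ijn; first by split => //; apply: cU; rewrite -ijn leq_addr.
  have ltin : (i < n)%N by rewrite -ijn addnS ltnS leq_addr.
  split; first exact/cU/ltnW.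
  have [_ fq] := (quot_extP _ _ (oD i)).1 (extU i (fn i ltin)).
  exists (Upsilon U f i.+1); split => //.
  by rewrite next_mask1 mdom1; have := IH i.+1; apply; rewrite -ijn addnS.
have H i j : (i + j = n)%N -> mclass true j 1%:M (brdom U i) (Upsilon U f i).
  elim: i j => [|i IH] j ijn; first by rewrite -ijn in fn.
  have [ci [g [gP gn]]] := IH j.+1 (etrans (addnS _ _) ijn).
  have cg := mclass_cont gn.
  have eg : ext i g by apply/quot_extP.
  have [cU UP] := (quot_extP _ _ (oD i)).1 (extU i (ex_intro _ g eg)).
  rewrite next_mask1 mdom1 in gn; apply: (mclass_eq (oD i.+1) _ gn) => p /set_mem Up.
  apply: (mquot_unique (oD i) gP UP cg cU).
  by rewrite mdom1.
split; first by apply/within_contP => //; exact: mclass_cont fn.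
move=> k kn; have := H k (n - k)%N (subnKC (ltnW kn)).
rewrite -(subnSK kn) => -[_ [g [gP gn]]].
exists g; apply/quot_extP => //; split => //; exact: mclass_cont gn.
Qed.

End BracketClass.

(** * Iterated quotients with fixed directions and steps *)

Section IteratedQuotients.
Variables (R : realType) (K : nonArchFieldType R).

Definition dquot m l (v : 'rV[K]_m) (t : K) (F : 'rV[K]_m -> 'rV[K]_l) x :=
  t^-1 *: (F (x + t *: v) - F x).

(** Directions and steps are families indexed by nat, so that an index can be
    replaced or removed without changing types. *)
Fixpoint dquots m l (F : 'rV[K]_m -> 'rV[K]_l) (k : nat)
    (v : nat -> 'rV[K]_m) (t : nat -> K) : 'rV[K]_m -> 'rV[K]_l :=
  if k is k'.+1 then dquot (v k') (t k') (dquots F k' v t) else F.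

Definition mxof k m (v : nat -> 'rV[K]_m) : 'M[K]_(k, m) :=
  \matrix_(i < k, j < m) v i 0 j.
Definition rowof k (t : nat -> K) : 'rV[K]_k := \row_(i < k) t i.
Definition vof k m (V : 'M[K]_(k, m)) (i : nat) : 'rV[K]_m :=
  if insub i is Some j then row j V else 0.
Definition tof k (T : 'rV[K]_k) (i : nat) : K :=
  if insub i is Some j then T 0 j else 0.

Lemma vofE k m (V : 'M[K]_(k, m)) (i : 'I_k) : vof V i = row i V.
Proof. by rewrite /vof valK. Qed.

Lemma tofE k (T : 'rV[K]_k) (i : 'I_k) : tof T i = T 0 i.
Proof. by rewrite /tof valK. Qed.

Lemma row_mxof k m (v : nat -> 'rV[K]_m) (i : 'I_k) : row i (mxof k v) = v i.
Proof. by apply/rowP => j; rewrite !mxE. Qed.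

Lemma vof_mxof k m (v : nat -> 'rV[K]_m) i : (i < k)%N -> vof (mxof k v) i = v i.
Proof. by move=> ik; rewrite (vofE _ (Ordinal ik)) row_mxof. Qed.

Lemma tof_rowof k (t : nat -> K) i : (i < k)%N -> tof (rowof k t) i = t i.
Proof. by move=> ik; rewrite (tofE _ (Ordinal ik)) mxE. Qed.

Section Commutation.
Variables (m l : nat).
Implicit Types (F : 'rV[K]_m -> 'rV[K]_l) (v w : nat -> 'rV[K]_m) (t : nat -> K).

Lemma eq_dquots F k v v' t t' :
  (forall i, (i < k)%N -> v i = v' i) -> (forall i, (i < k)%N -> t i = t' i) ->
  dquots F k v t = dquots F k v' t'.
Proof.
elim: k => //= k IH vv tt; rewrite vv ?tt// IH// => i ik.
  by apply: vv; rewrite ltnS ltnW.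
by apply: tt; rewrite ltnS ltnW.
Qed.

Lemma Phi_recE F k x V T : Phi_rec F k x V T = dquots F k (vof V) (tof T) x.
Proof.
elim: k x V T => // k IH x V T.
have E y : Phi_rec F k y (row' ord_max V) (col' ord_max T) =
    dquots F k (vof V) (tof T) y.
  rewrite IH; congr (_ y); apply: eq_dquots => i ik.
    rewrite (vofE _ (Ordinal ik)) (vofE _ (Ordinal (ltnW ik : (i < k.+1)%N))).
    by apply/rowP => j; rewrite !mxE; congr (V _ _); apply: val_inj; rewrite /= /bump leqNgt ik.
  rewrite (tofE _ (Ordinal ik)) (tofE _ (Ordinal (ltnW ik : (i < k.+1)%N))).
  by rewrite !mxE; congr (T _ _); apply: val_inj; rewrite /= /bump leqNgt ik.
rewrite /= !E /dquot (vofE V ord_max) (tofE T ord_max).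
by [].
Qed.

Lemma dquotC F (a b : 'rV[K]_m) (s r : K) :
  dquot a s (dquot b r F) = dquot b r (dquot a s F).
Proof.
apply/funext => x; rewrite /dquot -!scalerBr !scalerA mulrC.
congr (_ *: _); rewrite [x + s *: a + _]addrAC.
by apply/rowP => j; rewrite !mxE; ring.
Qed.

Fixpoint dquotl F (r : seq nat) v t :=
  if r is i :: r' then dquot (v i) (t i) (dquotl F r' v t) else F.

Lemma eq_dquotl F r v v' t t' :
  (forall i, i \in r -> v i = v' i) -> (forall i, i \in r -> t i = t' i) ->
  dquotl F r v t = dquotl F r v' t'.
Proof.
elim: r => //= i r IH vv tt; rewrite vv ?tt ?mem_head// IH// => j jr.
  by apply: vv; rewrite inE jr orbT.
by apply: tt; rewrite inE jr orbT.
Qed.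

Lemma dquots_list F k : exists r, (forall i, i \in r -> (i < k)%N) /\
  forall v t, dquots F k v t = dquotl F r v t.
Proof.
elim: k => [|k [r [rk rE]]]; first by exists [::].
exists (k :: r); split; last by move=> v t /=; rewrite rE.
by move=> i; rewrite inE => /orP[/eqP->//|/rk ik]; exact: ltnW.
Qed.

(** Since the operators commute, any index may be brought in front. *)
Lemma dquots_split F k i : (i < k)%N -> exists r, i \notin r /\
  forall v t, dquots F k v t = dquot (v i) (t i) (dquotl F r v t).
Proof.
elim: k i => // k IH i; rewrite ltnS leq_eqVlt => /orP[/eqP ->|ik].
  have [r [rk rE]] := dquots_list F k; exists r; split.
    by apply/negP => /rk; rewrite ltnn.
  by move=> v t /=; rewrite rE.
have [r [ir rE]] := IH i ik; exists (k :: r); split.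
  by rewrite inE negb_or ir andbT ltn_eqF.
by move=> v t /=; rewrite rE dquotC.
Qed.

Definition upd T (u : nat -> T) i x := fun j => if j == i then x else u j.

Definition mix v w (s : K) i : nat -> 'rV[K]_m :=
  fun j => if (j < i)%N then v j + s *: w j else v j.

Lemma upd_same T (u : nat -> T) i x : upd u i x i = x.
Proof. by rewrite /upd eqxx. Qed.

Lemma upd_other T (u : nat -> T) i x j : j != i -> upd u i x j = u j.
Proof. by rewrite /upd => /negbTE ->. Qed.

(** Compare the two values of the k-th quotient by moving the base point first,
    which gives a quotient of order k + 1, and then the directions one after
    the other.  As the i-th step is t i, changing v i into v i + s w i moves the
    points y' + t i v i by t i s w i; divided by s, this is a quotient of order
    k with i-th direction w i and i-th step t i s, based at y' + t i v i. *)
Lemma dquots_step F k v w t (s : K) y y1 :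
  dquots F k (fun i => v i + s *: w i) t (y + s *: y1) - dquots F k v t y =
  s *: (dquots F k.+1 (upd v k y1) (upd t k s) y +
    \sum_(i < k) dquots F k (upd (mix v w s i) i (w i)) (upd t i (t i * s))
                        (y + s *: y1 + t i *: v i)).
Proof.
have [->|s0] := eqVneq s 0.
  rewrite !scale0r addr0; apply/eqP; rewrite subr_eq0; apply/eqP.
  by congr (_ y); apply: eq_dquots => // i _; rewrite scale0r addr0.
set y' := y + s *: y1.
pose A i := dquots F k (mix v w s i) t y'.
have telescope j : (j <= k)%N -> A j - A 0%N = s *: \sum_(i < j)
    dquots F k (upd (mix v w s i) i (w i)) (upd t i (t i * s)) (y' + t i *: v i).
  elim: j => [|i IH] ik; first by rewrite big_ord0 subrr scaler0.
  rewrite big_ord_recr /= scalerDr -IH 1?ltnW//.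
  suff -> : A i.+1 = A i + s *: dquots F k (upd (mix v w s i) i (w i))
      (upd t i (t i * s)) (y' + t i *: v i) by rewrite addrAC.
  have [r [ir rE]] := dquots_split F ik; rewrite /A !rE.
  have ri j : j \in r -> j != i by apply: contraTneq => ->.
  rewrite (@eq_dquotl _ _ _ (mix v w s i) t t) => [|j /ri ji|//]; last first.
    by rewrite /mix ltnS leq_eqVlt (negbTE ji).
  rewrite (@eq_dquotl _ _ (upd _ _ _) (mix v w s i) (upd _ _ _) t) => [|j /ri ji|j /ri ji]; last 2 first.
  - by rewrite upd_other.
  - by rewrite upd_other.
  rewrite !upd_same /mix ltnSn ltnn; set P := dquotl _ _ _ _.
  have [->|t0] := eqVneq (t i) 0.
    by rewrite /dquot mul0r invr0 !scale0r scaler0 addr0.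
  rewrite /dquot.
  have -> : y' + t i *: (v i + s *: w i) = y' + t i *: v i + (t i * s) *: w i.
    by rewrite scalerDr scalerA addrA.
  by apply/rowP => j; rewrite !mxE; field; rewrite s0 t0.
have := telescope k (leqnn k).
have -> : A k = dquots F k (fun i => v i + s *: w i) t y'.
  by congr (_ y'); apply: eq_dquots => // i ik; rewrite /mix ik.
have -> : A 0%N = dquots F k v t y' by [].
rewrite scalerDr => <- /=.
have -> : dquots F k (upd v k y1) (upd t k s) = dquots F k v t.
  by apply: eq_dquots => i ik; rewrite upd_other// ltn_eqF.
rewrite !upd_same /dquot scalerA mulfV// scale1r.
by rewrite [RHS]addrC addrA subrK.
Qed.

End Commutation.

End IteratedQuotients.

(** * From quotients in the base point to quotients along masks *)

Section PhiTopology.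
Variables (R : realType) (K : nonArchFieldType R) (m k : nat).

Lemma mx_cont_sum (X : topologicalType) (x : X) m1 m2 I (r : seq I) (P : pred I)
    (F : I -> X -> 'M[K]_(m1, m2)) : (forall i, P i -> continuous_at x (F i)) ->
  continuous_at x (fun z => \sum_(i <- r | P i) F i z).
Proof.
move=> cF; elim: r => [|i r IH].
  have -> : (fun z => \sum_(i <- [::] | P i) F i z) = (fun=> 0).
    by apply/funext => z; rewrite big_nil.
  exact: cst_continuous.
have -> : (fun z => \sum_(j <- i :: r | P j) F j z) = (fun z =>
    (if P i then F i z else 0) + \sum_(j <- r | P j) F j z).
  by apply/funext => z; rewrite big_cons; case: ifP => // _; rewrite add0r.
apply: mx_contD => //; have [Pi|_] := boolP (P i); first exact: cF.
exact: cst_continuous.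
Qed.

Lemma phi_x_cont : continuous (fun p : phi_space K m k => p.1.1).
Proof.
move=> p; apply: (@continuous_comp _ _ _ (fun q : phi_space K m k => q.1) fst).
  exact: cvg_fst.
exact: cvg_fst.
Qed.

Lemma phi_v_cont : continuous (fun p : phi_space K m k => p.1.2).
Proof.
move=> p; apply: (@continuous_comp _ _ _ (fun q : phi_space K m k => q.1) snd).
  exact: cvg_fst.
exact: cvg_snd.
Qed.

Lemma phi_t_cont : continuous (fun p : phi_space K m k => p.2).
Proof. by move=> p; exact: cvg_snd. Qed.

Lemma row_cont (X : topologicalType) (x : X) (V : X -> 'M[K]_(k, m)) i :
  continuous_at x V -> continuous_at x (fun z => row i (V z)).
Proof.
move=> /mx_contP cV; apply/mx_contP => i' j.
have -> : (fun z => row i (V z) i' j) = (fun z => V z i j).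
  by apply/funext => z; rewrite mxE.
exact: cV.
Qed.

Lemma phi_pair_cont (X : topologicalType) (x : X) (y : X -> 'rV[K]_m)
    (V : X -> 'M[K]_(k, m)) (T : X -> 'rV[K]_k) :
  continuous_at x y -> continuous_at x V -> continuous_at x T ->
  continuous_at x (fun z => (y z, V z, T z) : phi_space K m k).
Proof.
move=> cy cV cT.
apply: (@cvg_pair _ _ _ (nbhs x) (nbhs (y x, V x)) (nbhs (T x)) _ _ _
  (fun z => (y z, V z)) T) => //.
exact: (@cvg_pair _ _ _ (nbhs x) (nbhs (y x)) (nbhs (V x)) _ _ _ y V).
Qed.

Lemma phi_dom_open (U : set 'rV[K]_m) : open U -> open (phi_dom U k).
Proof.
move=> oU; rewrite openE => p Up.
pose vertex (J : {set 'I_k}) (q : phi_space K m k) : 'rV[K]_m :=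
  q.1.1 + \sum_(i in J) q.2 0 i *: row i q.1.2.
have : \forall q \near p, forall J, U (vertex J q).
  apply: (@filter_forall _ _ (fun J q => U (vertex J q)) (nbhs p)) => J.
  have cJ : continuous_at p (vertex J).
    apply: mx_contD; first exact: phi_x_cont.
    apply: mx_cont_sum => i _; apply: mx_contZ.
      by have /mx_contP := @phi_t_cont p; exact.
    by apply: row_cont; exact: phi_v_cont.
  exact: (cJ U (open_nbhs_nbhs (conj oU (Up J)))).
exact.
Qed.

End PhiTopology.

(** On a ball, which is a coset of a subgroup, all the intermediate points that
    appear in [dquots_step] remain in the domain. *)
Section BallExtension.
Variables (R : realType) (K : nonArchFieldType R) (d l n : nat).
Variables (f : 'rV[K]_d -> 'rV[K]_l) (b0 : 'rV[K]_d) (r : R).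
Variable g : forall k, phi_space K d k -> 'rV[K]_l.

Local Notation B := (nball b0 r).
Local Notation H := (nball (0 : 'rV[K]_d) r).

Hypothesis gP : forall k, (k <= n)%N ->
  is_cont_ext (phi_dom B k) (phi_gen k) (Phi f k) (@g k).

Lemma nball0P (u : 'rV[K]_d) : H u <-> forall i, nabs (u 0 i) < r.
Proof. by split=> Hu i; have := Hu i; rewrite mxE sub0r nabsN. Qed.

Lemma nballD x u : B x -> H u -> B (x + u).
Proof.
move=> Bx /nball0P Hu i; rewrite mxE opprD addrA; apply: nabsD_lt; first exact: Bx.
by rewrite nabsN.
Qed.

Lemma nball0D u v : H u -> H v -> H (u + v).
Proof.
by move=> /nball0P Hu /nball0P Hv; apply/nball0P => i; rewrite mxE; exact: nabsD_lt.
Qed.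

Lemma nballB x y : B x -> B y -> H (x - y).
Proof.
move=> Bx By; apply/nball0P => i; rewrite !mxE -(subrK (b0 0 i) (x 0 i)) -addrA.
by apply: nabsD_lt; [rewrite nabsBC; exact: Bx|exact: By].
Qed.

Lemma nball0N u : H u -> H (- u).
Proof. by move=> /nball0P Hu; apply/nball0P => i; rewrite mxE nabsN. Qed.

Lemma nball0B u v : H u -> H v -> H (u - v).
Proof. by move=> Hu Hv; apply: nball0D => //; exact: nball0N. Qed.

Definition phi k (y : 'rV[K]_d) (v : nat -> 'rV[K]_d) (t : nat -> K) : 'rV[K]_l :=
  @g k (y, mxof k v, rowof k t).

(** For a ball this amounts to requiring that all the vertices of the
    parallelepiped belong to it. *)
Definition in_box k y (v : nat -> 'rV[K]_d) (t : nat -> K) :=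
  B y /\ forall i, (i < k)%N -> H (t i *: v i).

Lemma eq_phi k y v v' t t' : (forall i, (i < k)%N -> v i = v' i) ->
  (forall i, (i < k)%N -> t i = t' i) -> phi k y v t = phi k y v' t'.
Proof.
move=> vv tt; rewrite /phi.
have -> : mxof k v = mxof k v' by apply/matrixP => i j; rewrite !mxE vv.
by have -> : rowof k t = rowof k t' by apply/matrixP => i j; rewrite !mxE tt.
Qed.

Lemma in_box_dom k y v t : in_box k y v t ->
  phi_dom B k ((y, mxof k v, rowof k t) : phi_space K d k).
Proof.
move=> [By Hv] J /=; elim/big_rec: _ => [|i x _ Bx]; first by rewrite addr0.
by rewrite row_mxof mxE addrCA addrC; apply: nballD => //; exact: Hv.
Qed.

Lemma phi_dquots k y v t : (k <= n)%N -> in_box k y v t ->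
  (forall i, (i < k)%N -> t i != 0) -> phi k y v t = dquots f k v t y.
Proof.
move=> kn box t0; have [_ gE] := gP kn.
rewrite /phi gE; first last.
- by move=> i /=; rewrite mxE; exact: t0.
- exact: in_box_dom.
rewrite /Phi /= Phi_recE; congr (_ y); apply: eq_dquots => i ik.
  exact: vof_mxof.
exact: tof_rowof.
Qed.

Lemma phi_cont k (X : topologicalType) (x : X) (y : X -> 'rV[K]_d)
    (v : nat -> X -> 'rV[K]_d) (t : nat -> X -> K) : (k <= n)%N ->
  continuous_at x y -> (forall i, (i < k)%N -> continuous_at x (v i)) ->
  (forall i, (i < k)%N -> continuous_at x (t i)) ->
  in_box k (y x) (v^~ x) (t^~ x) ->
  continuous_at x (fun z => phi k (y z) (v^~ z) (t^~ z)).
Proof.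
move=> kn cy cv ct box; have [cg _] := gP kn.
move/within_contP : cg => cg.
apply: (@continuous_comp _ _ _ (fun z =>
  ((y z, mxof k (v^~ z), rowof k (t^~ z)) : phi_space K d k)) (@g k)); last first.
  by apply: cg; [exact/phi_dom_open/nball_open|exact: in_box_dom].
apply: phi_pair_cont => //.
  apply/mx_contP => i j.
  have -> : (fun z => mxof k (v^~ z) i j) = (fun z => v i z 0 j).
    by apply/funext => z; rewrite mxE.
  by have /mx_contP := cv i (ltn_ord i); exact.
apply/mx_contP => i j.
have -> : (fun z => rowof k (t^~ z) i j) = t j.
  by apply/funext => z; rewrite mxE.
exact: ct.
Qed.

Lemma in_box_step k y v w t s y1 :
  in_box k y v t -> H (s *: y1) -> (forall i, (i < k)%N -> H ((t i * s) *: w i)) ->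
  [/\ in_box k (y + s *: y1) (fun i => v i + s *: w i) t,
    in_box k.+1 y (upd v k y1) (upd t k s) &
    forall i, (i < k)%N -> in_box k (y + s *: y1 + t i *: v i)
      (upd (mix v w s i) i (w i)) (upd t i (t i * s))].
Proof.
move=> [By Hv] Hy1 Hw.
have Hvw i : (i < k)%N -> H (t i *: (v i + s *: w i)).
  by move=> ik; rewrite scalerDr scalerA; apply: nball0D; [exact: Hv|exact: Hw].
split.
- by split; [exact: nballD|].
- split=> // i; rewrite ltnS leq_eqVlt => /orP[/eqP ->|ik]; first by rewrite !upd_same.
  by rewrite !upd_other ?ltn_eqF//; exact: Hv.
- move=> i ik; split; first by apply: nballD; [exact: nballD|exact: Hv].
  move=> j jk; have [->|ji] := eqVneq j i; first by rewrite !upd_same; exact: Hw.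
  by rewrite !upd_other// /mix; case: ifP => _; [exact: Hvw|exact: Hv].
Qed.

(** The identity [dquots_step] for the continuous extensions: replace the
    vanishing steps t i by a small e <> 0, for which the extensions are genuine
    quotients, and let e tend to 0. *)
Lemma phi_step k y v w t s y1 : (k < n)%N ->
  in_box k y v t -> H (s *: y1) -> (forall i, (i < k)%N -> H ((t i * s) *: w i)) ->
  phi k (y + s *: y1) (fun i => v i + s *: w i) t - phi k y v t =
  s *: (phi k.+1 y (upd v k y1) (upd t k s) +
    \sum_(i < k) phi k (y + s *: y1 + t i *: v i)
                       (upd (mix v w s i) i (w i)) (upd t i (t i * s))).
Proof.
move=> kn box Hy1 Hw.
have [->|s0] := eqVneq s 0.
  rewrite !scale0r addr0; apply/eqP; rewrite subr_eq0; apply/eqP.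
  by apply: eq_phi => // i _; rewrite scale0r addr0.
pose te i (e : K) := if t i == 0 then e else t i.
have te0 i : te i 0 = t i by rewrite /te; case: eqP.
have te0E : te^~ 0 = t by apply/funext.
have cte i : continuous_at 0 (te i).
  rewrite /te; case: (t i == 0); last exact: cst_continuous.
  exact: cvg_id.
have near_box : \forall e \near (0 : K), in_box k y v (te^~ e) /\
    forall i, (i < k)%N -> H ((te i e * s) *: w i).
  have nearH i (u : K -> 'rV[K]_d) : continuous_at 0 u -> H (u 0) ->
      \forall e \near (0 : K), H (u e).
    move=> cu Hu; apply: (cu H); apply: open_nbhs_nbhs; split => //.
    exact: nball_open.
  have H1 : \forall e \near (0 : K), forall i : 'I_k, H (te i e *: v i).
    apply: filter_forall => i; apply: nearH => //.
      by apply: mx_contZ => //; exact: cst_continuous.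
    by rewrite te0; exact: box.2.
  have H2 : \forall e \near (0 : K), forall i : 'I_k, H ((te i e * s) *: w i).
    apply: filter_forall => i; apply: nearH => //.
      apply: mx_contZ; last exact: cst_continuous.
      by apply: nabs_contM => //; exact: cst_continuous.
    by rewrite te0; exact: Hw.
  apply: filterS2 H1 H2 => e H1 H2; split; last by move=> i ik; exact: (H2 (Ordinal ik)).
  by split; [exact: box.1|move=> i ik; exact: (H1 (Ordinal ik))].
have [box1 box2 box3] := in_box_step box Hy1 Hw.
rewrite -te0E.
apply: (@punctured_eq _ _ _ _ (fun e =>
    phi k (y + s *: y1) (fun i => v i + s *: w i) (te^~ e) - phi k y v (te^~ e))
  (fun e => s *: (phi k.+1 y (upd v k y1) (upd (te^~ e) k s) +
    \sum_(i < k) phi k (y + s *: y1 + te i e *: v i)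
                       (upd (mix v w s i) i (w i)) (upd (te^~ e) i (te i e * s)))) 0).
- apply: mx_contB.
    apply: (@phi_cont k _ _ (fun=> y + s *: y1) (fun i _ => v i + s *: w i) te).
    + exact: ltnW.
    + exact: cst_continuous.
    + by move=> *; exact: cst_continuous.
    + by [].
    + by rewrite te0E.
  apply: (@phi_cont k _ _ (fun=> y) (fun i _ => v i) te).
  + exact: ltnW.
  + exact: cst_continuous.
  + by move=> *; exact: cst_continuous.
  + by [].
  + by rewrite te0E.
- apply: mx_contZ; first exact: cst_continuous.
  apply: mx_contD.
    apply: (@phi_cont k.+1 _ _ (fun=> y) (fun i _ => upd v k y1 i)
      (fun i e => upd (te^~ e) k s i)) => //.
    + exact: cst_continuous.
    + by move=> *; exact: cst_continuous.
    + by move=> i _; rewrite /upd; case: eqP => // _; exact: cst_continuous.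
    + by rewrite te0E.
  apply: mx_cont_sum => i _.
  apply: (@phi_cont k _ _ (fun e => y + s *: y1 + te i e *: v i)
     (fun j _ => upd (mix v w s i) i (w i) j)
     (fun j e => upd (te^~ e) i (te i e * s) j)).
  + exact: ltnW.
  + apply: mx_contD; first exact: cst_continuous.
    by apply: mx_contZ => //; exact: cst_continuous.
  + by move=> *; exact: cst_continuous.
  + move=> j _; rewrite /upd; case: eqP => // _.
    by apply: nabs_contM => //; exact: cst_continuous.
  + by rewrite te0E te0; exact: box3.
apply: filterS near_box => e [ebox eHw] e0.
have [ebox1 ebox2 ebox3] := in_box_step ebox Hy1 eHw.
have ten i : te i e != 0 by rewrite /te; case: ifPn.
have ten_upd i x j : x != 0 -> upd (te^~ e) i x j != 0.
  by move=> x0; rewrite /upd; case: (j == i).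
rewrite (phi_dquots (ltnW kn) ebox1)// (phi_dquots (ltnW kn) ebox)//.
rewrite (phi_dquots kn ebox2) => [|i _]; last exact: ten_upd.
rewrite dquots_step; congr (_ *: (_ + _)); apply: eq_bigr => i _.
rewrite (phi_dquots (ltnW kn) (ebox3 i (ltn_ord i)))// => j _.
by apply: ten_upd; rewrite mulf_neq0.
Qed.

(** By [phi_step] the quotient of such a function is a sum of functions of the
    same form, of order at most k + 1.  The steps have to be constant along the
    mask; this remains true of the new steps, qt p and t i (qx p) * qt p, because
    the variable qt p is inactive for [next_mask false]. *)
Lemma mclass_phi q m (Pi : 'M[K]_m) D k (y : 'rV[K]_m -> 'rV[K]_d) v
    (t : nat -> 'rV[K]_m -> K) : (k + q <= n)%N ->
  (forall z, D z -> in_box k (y z) (v^~ z) (t^~ z)) ->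
  mclass false q Pi D y -> (forall i, (i < k)%N -> mclass false q Pi D (v i)) ->
  (forall i, (i < k)%N -> mclass false q Pi D (fun z => (t i z)%:M : 'rV[K]_1)) ->
  (forall i p, (i < k)%N -> mdom Pi D p -> t i (endpoint Pi p) = t i (qx p)) ->
  mclass false q Pi D (fun z => phi k (y z) (v^~ z) (t^~ z)).
Proof.
have tcont m' (Pi' : 'M[K]_m') D' q' (s : _ -> K) :
    mclass false q' Pi' D' (fun z => (s z)%:M : 'rV[K]_1) -> cont_on D' s.
  move=> /mclass_cont cs z Dz.
  have -> : s = (fun z => ((s z)%:M : 'rV[K]_1) 0 0).
    by apply/funext => w; rewrite mxE eqxx.
  by have /mx_contP := cs z Dz; apply.
have phi_cont_on m' (D' : set 'rV[K]_m') k' (y' : _ -> 'rV[K]_d) v' (t' : nat -> _ -> K) :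
    (k' <= n)%N -> (forall z, D' z -> in_box k' (y' z) (v'^~ z) (t'^~ z)) ->
    cont_on D' y' -> (forall i, (i < k')%N -> cont_on D' (v' i)) ->
    (forall i, (i < k')%N -> cont_on D' (t' i)) ->
    cont_on D' (fun z => phi k' (y' z) (v'^~ z) (t'^~ z)).
  move=> kn box cy cv ct z Dz; apply: phi_cont => //.
  - exact: cy.
  - by move=> i ik; exact: cv.
  - by move=> i ik; exact: ct.
  - exact: box.
elim: q m Pi D k y v t => [|q IH] m Pi D k y v t kqn box cy cv ct tpass.
  split=> //; rewrite addn0 in kqn; apply: phi_cont_on => //.
  - exact: mclass_cont cy.
  - by move=> i ik; exact: mclass_cont (cv i ik).
  - by move=> i ik; exact: tcont (ct i ik).
have kn : (k < n)%N by apply: leq_trans kqn; rewrite addnS ltnS leq_addr.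
split.
  apply: phi_cont_on => //; first exact: ltnW.
  - exact: mclass_cont cy.
  - by move=> i ik; exact: mclass_cont (cv i ik).
  - by move=> i ik; exact: tcont (ct i ik).
have cy' := mclassW cy.
have [_ [y1 [y1P cy1]]] := cy.
have /choice[w wP] : forall i, exists w, (i < k)%N ->
    is_mquot Pi D (v i) w /\ mclass false q (next_mask false Pi) (mdom Pi D) w.
  move=> i; case: (ltnP i k) => ik; last by exists (fun=> 0).
  by have [_ [w wP]] := cv i ik; exists w.
have yE p : mdom Pi D p -> y (endpoint Pi p) = y (qx p) + qt p *: y1 p.
  by move=> Dp; rewrite y1P// addrC subrK.
have vE p i : (i < k)%N -> mdom Pi D p -> v i (endpoint Pi p) = v i (qx p) + qt p *: w i p.
  by move=> ik Dp; rewrite (wP i ik).1// addrC subrK.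
have boxx p : mdom Pi D p -> in_box k (y (qx p)) (v^~ (qx p)) (t^~ (qx p)).
  by case=> Dx _; exact: box.
have Hy1 p : mdom Pi D p -> H (qt p *: y1 p).
  by move=> [Dx Ds]; rewrite y1P//; apply: nballB; apply: (box _ _).1.
have Hw p i : (i < k)%N -> mdom Pi D p -> H ((t i (qx p) * qt p) *: w i p).
  move=> ik Dp; have [Dx Ds] := Dp.
  rewrite -scalerA (wP i ik).1// scalerBr -{1}(tpass i p ik Dp).
  by apply: nball0B; exact: (box _ _).2.
have steps p : mdom Pi D p -> _ := fun Dp => in_box_step (boxx p Dp) (Hy1 p Dp)
  (fun i ik => Hw p i ik Dp).
exists (fun p => phi k.+1 (y (qx p)) (upd (v^~ (qx p)) k (y1 p)) (upd (t^~ (qx p)) k (qt p)) +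
    \sum_(i < k) phi k (y (qx p) + qt p *: y1 p + t i (qx p) *: v i (qx p))
      (upd (mix (v^~ (qx p)) (w^~ p) (qt p) i) i (w i p))
      (upd (t^~ (qx p)) i (t i (qx p) * qt p))); split.
  move=> p Dp; rewrite -phi_step//; [|exact: boxx|exact: Hy1|by move=> i ik; exact: Hw].
  rewrite yE//; congr (_ - _); apply: eq_phi => i ik; first by rewrite vE.
  by rewrite tpass.
have DqxV V (h : _ -> 'rV[K]_V) : mclass false q.+1 Pi D h ->
    mclass false q (next_mask false Pi) (mdom Pi D) (h \o @qx R K m).
  by move=> /mclassW hD; apply: mclass_qx hD => p [].
have cqt := @mclass_qt R K false q m (next_mask false Pi) (mdom Pi D).
have qxpass p : mdom (next_mask false Pi) (mdom Pi D) p -> forall i, (i < k)%N ->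
    t i (qx (endpoint (next_mask false Pi) p)) = t i (qx (qx p)).
  move=> [[Dxx _] [Dsx _]] i ik.
  have := tpass i (qmk (qx (qx p)) (qx (qv p)) (qt p)) ik.
  have -> : endpoint Pi (qmk (qx (qx p)) (qx (qv p)) (qt p)) = qx (endpoint (next_mask false Pi) p).
    by rewrite endpoint_next /endpoint !qmkE.
  rewrite qmkE; apply; split; rewrite ?qmkE//.
  by move: Dsx; rewrite endpoint_next /endpoint !qmkE.
have qtpass p : qt (endpoint (next_mask false Pi) p) = qt (qx p).
  by rewrite endpoint_next qmkE mul0r mulr0 addr0.
have ctq i : (i < k)%N ->
    mclass false q (next_mask false Pi) (mdom Pi D) (fun p => (t i (qx p) * qt p)%:M : 'rV[K]_1).
  move=> ik; have -> : (fun p => (t i (qx p) * qt p)%:M : 'rV[K]_1) =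
      (fun p => ((t i (qx p))%:M : 'rV[K]_1) 0 0 *: ((qt p)%:M : 'rV[K]_1)).
    by apply/funext => p; rewrite mxE eqxx mulr1n scale_scalar_mx.
  apply: (@mclassZ _ _ _ _ _ _ _ _ (fun p => (t i (qx p))%:M)) => //.
  exact: (DqxV _ _ (ct i ik)).
have cyq : mclass false q (next_mask false Pi) (mdom Pi D) (fun p => y (qx p) + qt p *: y1 p).
  apply: mclassD; first exact: DqxV.
  have -> : (fun p => qt p *: y1 p) = (fun p => ((qt p)%:M : 'rV[K]_1) 0 0 *: y1 p).
    by apply/funext => p; rewrite mxE eqxx mulr1n.
  exact: (@mclassZ _ _ _ _ _ _ _ _ (fun p => (qt p)%:M)).
apply: mclassD.
  apply: (IH _ _ _ k.+1 (fun p => y (qx p)) (fun i p => upd (v^~ (qx p)) k (y1 p) i)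
    (fun i p => upd (t^~ (qx p)) k (qt p) i)).
  - by rewrite addSnnS.
  - by move=> p /steps[].
  - exact: DqxV.
  - move=> i; rewrite ltnS leq_eqVlt /upd; case: eqVneq => //= _ ik.
    exact: DqxV (cv i ik).
  - move=> i; rewrite ltnS leq_eqVlt /upd; case: eqVneq => //= _ ik.
    exact: (DqxV _ _ (ct i ik)).
  - move=> i p; rewrite ltnS leq_eqVlt /upd; case: eqVneq => //= _ ik Dp.
    exact: qxpass.
apply: mclass_sum => i _; have ik := ltn_ord i.
apply: (IH _ _ _ k (fun p => y (qx p) + qt p *: y1 p + t i (qx p) *: v i (qx p))
  (fun j p => upd (mix (v^~ (qx p)) (w^~ p) (qt p) i) i (w i p) j)
  (fun j p => upd (t^~ (qx p)) i (t i (qx p) * qt p) j)).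
- by apply: leq_trans kqn; rewrite leq_add2l.
- by move=> p /steps[_ _]; exact.
- apply: mclassD => //.
  have -> : (fun p => t i (qx p) *: v i (qx p)) =
      (fun p => ((t i (qx p))%:M : 'rV[K]_1) 0 0 *: v i (qx p)).
    by apply/funext => p; rewrite mxE eqxx mulr1n.
  apply: (@mclassZ _ _ _ _ _ _ _ _ (fun p => (t i (qx p))%:M)).
    exact: (DqxV _ _ (ct i ik)).
  exact: DqxV (cv i ik).
- move=> j jk; rewrite /upd; case: eqVneq => _; first exact: (wP i ik).2.
  rewrite /mix; case: ltnP => _; last exact: DqxV (cv j jk).
  apply: mclassD; first exact: DqxV (cv j jk).
  have -> : (fun p => qt p *: w j p) = (fun p => ((qt p)%:M : 'rV[K]_1) 0 0 *: w j p).
    by apply/funext => p; rewrite mxE eqxx mulr1n.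
  apply: (@mclassZ _ _ _ _ _ _ _ _ (fun p => (qt p)%:M)) => //.
  exact: (wP j jk).2.
- move=> j jk; rewrite /upd; case: eqVneq => _; first exact: ctq.
  exact: (DqxV _ _ (ct j jk)).
- move=> j p jk Dp; rewrite /upd; case: eqVneq => _; rewrite ?qtpass qxpass//.
Qed.

Lemma ball_mclass : mclass false n 1%:M B f.
Proof.
have [_ gE] := gP (leq0n n).
have fE x : B x -> phi 0 x (fun=> 0) (fun=> 0) = f x.
  by move=> Bx; rewrite phi_dquots.
apply: (@mclass_eq _ _ _ _ _ _ _ _ (fun x => phi 0 x (fun=> 0) (fun=> 0))).
- exact: nball_open.
- by move=> x /set_mem; exact: fE.
apply: (@mclass_phi _ _ _ _ 0 id (fun _ _ => 0) (fun _ _ => 0)) => //.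
have -> : id = (fun x : 'rV[K]_d => x *m 1%:M) by apply/funext => x; rewrite mulmx1.
exact: mclass_lin.
Qed.

End BallExtension.

(** * From quotients along masks to quotients in the base point *)

Section OrdinaryClass.
Variables (R : realType) (K : nonArchFieldType R).

(** The recursion defining the iterated quotient adds the outermost quotient
    last; here the innermost one is taken off, as [mclass] proceeds. *)
Lemma dquots_first m l (F : 'rV[K]_m -> 'rV[K]_l) k v t :
  dquots F k.+1 v t =
  dquots (dquot (v 0%N) (t 0%N) F) k (fun i => v i.+1) (fun i => t i.+1).
Proof. by elim: k => // k IH; rewrite [LHS]/= -/(dquots F k.+1 v t) IH. Qed.

Lemma dquots_qmk m l (F : 'rV[K]_(m + m + 1) -> 'rV[K]_l) k v t z w t0 :
  dquots F k (fun i => qmk (v i) 0 0) t (qmk z w t0) =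
  dquots (fun x => F (qmk x w t0)) k v t z.
Proof.
elim: k z => //= k IH z; rewrite /dquot -!IH; congr (_ *: (dquots _ _ _ _ _ - _)).
by apply: qP; rewrite ?qxD ?qvD ?qtD ?qxZ ?qvZ ?qtZ !qmkE// ?scaler0 ?mulr0 addr0.
Qed.

(** The vertices of the parallelepiped are selected by predicates on nat and not
    by sets of ordinals: removing the first index is then a shift. *)
Definition box_dom d m k (D : set 'rV[K]_m) (E : 'M[K]_(d, m)) z
    (V : 'M[K]_(k, d)) (T : 'rV[K]_k) :=
  forall P : pred nat,
    D (z + \sum_(i < k) (if P i then tof T i *: (vof V i *m E) else 0)).

(** Quotients in the base point only are obtained from quotients along a mask by
    giving the value 0 to the velocities of all the other variables.  The
    directions are embedded by E into the active part of the space.  Continuity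
    is stated along arbitrary continuous families of arguments, so that the
    induction only has to compose such families. *)
Lemma mclass_dquots d l k n m (Pi : 'M[K]_m) D (F : _ -> 'rV[K]_l) (E : 'M[K]_(d, m)) :
  open D -> (k <= n)%N -> E *m Pi = E -> mclass false n Pi D F ->
  exists G : 'rV[K]_m -> 'M[K]_(k, d) -> 'rV[K]_k -> 'rV[K]_l,
    (forall (X : topologicalType) (x : X) z V T,
       continuous_at x z -> continuous_at x V -> continuous_at x T ->
       box_dom D E (z x) (V x) (T x) ->
       continuous_at x (fun u => G (z u) (V u) (T u))) /\
    (forall z V T, box_dom D E z V T -> (forall i, T 0 i != 0) ->
       G z V T = dquots F k (fun i => vof V i *m E) (tof T) z).
Proof.
elim: k n m Pi D F E => [|k IH] n m Pi D F E oD kn EPi Fn.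
  exists (fun z _ _ => F z); split => // X x z V T cz _ _ box.
  apply: continuous_comp; first exact: cz.
  apply: (mclass_cont Fn); have := box xpredT.
  by rewrite big_ord0 addr0.
case: n kn Fn => // n kn [_ [F1 [F1P F1n]]].
pose F1' p := if qt p == 0 then F1 p else (qt p)^-1 *: (F (endpoint Pi p) - F (qx p)).
have {}F1n : mclass false n (next_mask false Pi) (mdom Pi D) F1'.
  apply: mclass_eq F1n; first exact: mdom_open.
  move=> p /set_mem Dp; rewrite /F1'; case: eqVneq => // p0.
  by apply: (scalerI p0); rewrite F1P// scalerA mulfV// scale1r.
pose E' : 'M[K]_(d, m + m + 1) := row_mx (row_mx E 0) 0.
have vE' v : v *m E' = qmk (v *m E) 0 0.
  rewrite /qmk /E' !mul_mx_row !mulmx0.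
  by have -> : (0 : K)%:M = 0 :> 'M[K]_1 by rewrite raddf0.
have E'mask : E' *m next_mask false Pi = E'.
  apply/row_matrixP => i; rewrite row_mul mulmx_next_mask.
  have -> : row i E' = qmk (row i E) 0 0 by rewrite !rowE vE'.
  by rewrite !qmkE -row_mul EPi mulr0.
have [G' [G'c G'E]] := IH n _ _ _ F1' E' (mdom_open oD) kn E'mask F1n.
have vof0 (V : 'M[K]_(k.+1, d)) : vof V 0 = row ord0 V by exact: (vofE V ord0).
have tof0 (T : 'rV[K]_k.+1) : tof T 0 = T 0 ord0 by exact: (tofE T ord0).
have vofS (V : 'M[K]_(k.+1, d)) i : vof (row' ord0 V) i = vof V i.+1.
  rewrite /vof; case: insubP => [j _ <-|ik].
    rewrite (_ : j.+1 = lift ord0 j :> nat)// valK.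
    by apply/rowP => a; rewrite !mxE.
  by case: insubP => // j; rewrite ltnS (negbTE ik).
have tofS (T : 'rV[K]_k.+1) i : tof (col' ord0 T) i = tof T i.+1.
  rewrite /tof; case: insubP => [j _ <-|ik].
    by rewrite (_ : j.+1 = lift ord0 j :> nat)// valK mxE.
  by case: insubP => // j; rewrite ltnS (negbTE ik).
have box' z (V : 'M[K]_(k.+1, d)) (T : 'rV[K]_k.+1) : box_dom D E z V T ->
    box_dom (mdom Pi D) E' (qmk z (row ord0 V *m E) (T 0 ord0)) (row' ord0 V) (col' ord0 T).
  move=> box P.
  have -> : \sum_(i < k) (if P i then tof (col' ord0 T) i *: (vof (row' ord0 V) i *m E') else 0) =
      qmk (\sum_(i < k) (if P i then tof T i.+1 *: (vof V i.+1 *m E) else 0)) 0 0.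
    have q0 : [/\ qx (0 : 'rV[K]_(m + m + 1)) = 0, qv (0 : 'rV[K]_(m + m + 1)) = 0 &
        qt (0 : 'rV[K]_(m + m + 1)) = 0].
      by rewrite -(scale0r 0) qxZ qvZ qtZ !scale0r mul0r.
    have [x0 v0 t0] := q0.
    apply: qP; rewrite qmkE.
    - rewrite (big_morph _ (@qxD R K m) x0); apply: eq_bigr => i _.
      by rewrite vofS tofS; case: ifP => // _; rewrite qxZ vE' qmkE.
    - rewrite (big_morph _ (@qvD R K m) v0) big1// => i _.
      by case: ifP => // _; rewrite qvZ vE' qmkE scaler0.
    - rewrite (big_morph _ (@qtD R K m) t0) big1// => i _.
      by case: ifP => // _; rewrite qtZ vE' qmkE mulr0.
  set S := \sum_(i < k) _.
  split.
    have := box (fun i => if i is i'.+1 then P i' else false).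
    by rewrite big_ord_recl /= add0r qxD !qmkE.
  have := box (fun i => if i is i'.+1 then P i' else true).
  rewrite big_ord_recl /= /endpoint qxD qvD qtD !qmkE !addr0 -mulmxA EPi vof0 tof0.
  by rewrite addrAC addrA.
exists (fun z (V : 'M[K]_(k.+1, d)) (T : 'rV[K]_k.+1) => G' (qmk z (row ord0 V *m E) (T 0 ord0)) (row' ord0 V) (col' ord0 T)).
split.
  move=> X x z V T cz cV cT box; apply: G'c; last exact: box'.
  - apply: qmk_cont => //; first by apply: mx_contMr; exact: row_cont.
    by have /mx_contP := cT; exact.
  - apply/mx_contP => i j.
    have -> : (fun u => row' ord0 (V u) i j) = (fun u => V u (lift ord0 i) j).
      by apply/funext => u; rewrite mxE.
    by have /mx_contP := cV; exact.
  - apply/mx_contP => i j.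
    have -> : (fun u => col' ord0 (T u) i j) = (fun u => T u i (lift ord0 j)).
      by apply/funext => u; rewrite mxE.
    by have /mx_contP := cT; exact.
move=> z V T box T0; rewrite G'E; last first.
- by move=> i; rewrite mxE.
- exact: box'.
rewrite dquots_first.
rewrite (@eq_dquots _ _ _ _ _ _ _ (fun i => qmk (vof V i.+1 *m E) 0 0) _ (fun i => tof T i.+1)).
- rewrite dquots_qmk; congr (dquots _ _ _ _ _); apply/funext => x.
  rewrite /F1' qmkE (negbTE (T0 ord0)) /endpoint !qmkE -mulmxA EPi.
  by rewrite /dquot vof0 tof0.
- by move=> i _; rewrite vofS vE'.
- by move=> i _; rewrite tofS.
Qed.

(** [ball_mclass] only applies to balls, and [mclass_local] removes this
    restriction. *)
Lemma ord_classP m l (U : set 'rV[K]_m) (f : _ -> 'rV[K]_l) n : open U ->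
  ord_class U f n <-> mclass false n 1%:M U f.
Proof.
move=> oU; split=> [[cf fn]|fn].
  apply: mclass_local => //; first by rewrite mulmx1.
  move=> x Ux; have /nballP[e e0 eU] := open_nbhs_nbhs (conj oU Ux).
  exists (nball x e); split.
  - exact: nball_open.
  - by move=> i; rewrite subrr nabs0.
  pose g k := xget (fun=> 0) [set g | is_cont_ext (phi_dom U k) (phi_gen k) (Phi f k) g].
  apply: (@ball_mclass _ _ _ _ _ _ _ _ g) => k kn.
  have [gc gE] : is_cont_ext (phi_dom U k) (phi_gen k) (Phi f k) (g k).
    exact: (xgetPex _ (fn k kn)).
  have BU : phi_dom (nball x e) k `<=` phi_dom U k by move=> p Bp J; exact/eU/Bp.
  by split; [exact: continuous_subspaceW gc|move=> p /BU; exact: gE].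
split; first by apply/within_contP => //; exact: mclass_cont fn.
move=> k kn; have E1 : (1%:M : 'M[K]_m) *m 1%:M = 1%:M by rewrite mulmx1.
have [G [Gc GE]] := mclass_dquots oU kn E1 fn.
have box (p : phi_space K m k) : phi_dom U k p -> box_dom U 1%:M p.1.1 p.1.2 p.2.
  move=> Up P; have := Up [set i : 'I_k | P i]%SET; congr (U (_ + _)).
  rewrite big_mkcond; apply: eq_bigr => i _.
  by rewrite inE mulmx1 vofE tofE.
exists (fun p : phi_space K m k => G p.1.1 p.1.2 p.2); split.
  apply/within_contP; first exact: phi_dom_open.
  move=> p Up; apply: (Gc _ p (fun q => q.1.1) (fun q => q.1.2) (fun q => q.2)).
  - exact: phi_x_cont.
  - exact: phi_v_cont.
  - exact: phi_t_cont.
  - exact: box.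
move=> p Up p0; rewrite GE//; last exact: box.
rewrite /Phi Phi_recE; congr (_ _); apply: eq_dquots => // i _.
by rewrite mulmx1.
Qed.

End OrdinaryClass.

(** * Classes of maps between open sets, charts and diffeomorphisms *)

Section ClassClosure.
Variables (R : realType) (K : nonArchFieldType R) (a : smoothness).

Definition is_bracket := if a is Cbr _ then true else false.

Lemma CclassP m l (U : set 'rV[K]_m) (f : _ -> 'rV[K]_l) : open U ->
  Cclass a U f <->
  forall n, leqx n (order_of a) -> mclass is_bracket n 1%:M U f.
Proof.
move=> oU; rewrite /Cclass /is_bracket; case: a => t.
  by split=> H n /H /(ord_classP _ _ oU).
by split=> H n /H /(br_classP _ _ oU).
Qed.

Lemma Cclass_cont m l (U : set 'rV[K]_m) (f : _ -> 'rV[K]_l) : open U ->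
  Cclass a U f -> cont_on U f.
Proof.
move=> oU /(CclassP _ oU)/(_ 0%N) fn; apply: mclass_cont (fn _).
by case: (order_of a).
Qed.

Lemma Cclass_eq m l (U : set 'rV[K]_m) (f g : _ -> 'rV[K]_l) : open U ->
  {in U, f =1 g} -> Cclass a U f -> Cclass a U g.
Proof.
move=> oU fg /(CclassP _ oU) fn; apply/(CclassP _ oU) => n /fn.
exact: mclass_eq.
Qed.

Lemma Cclass_sub m l (U V : set 'rV[K]_m) (f : _ -> 'rV[K]_l) :
  open U -> open V -> V `<=` U -> Cclass a U f -> Cclass a V f.
Proof.
move=> oU oV VU /(CclassP _ oU) fn; apply/(CclassP _ oV) => n /fn.
exact: mclass_sub.
Qed.

Lemma Cclass_comp m m' l (W : set 'rV[K]_m) (U : set 'rV[K]_m')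
    (f : _ -> 'rV[K]_l) (g : 'rV[K]_m -> 'rV[K]_m') : open W -> open U ->
  (forall x, W x -> U (g x)) -> Cclass a U f -> Cclass a W g ->
  Cclass a W (f \o g).
Proof.
move=> oW oU WU /(CclassP _ oU) fn /(CclassP _ oW) gn.
apply/(CclassP _ oW) => n nt.
apply: mclass_comp WU (fn n nt) (gn n nt) => p _.
by rewrite mulmx1.
Qed.

Lemma Cclass_local m l (U : set 'rV[K]_m) (f : _ -> 'rV[K]_l) : open U ->
  (forall x, U x -> exists N, [/\ open N, N x & Cclass a N f]) -> Cclass a U f.
Proof.
move=> oU locf; apply/(CclassP _ oU) => n nt; apply: mclass_local => //.
  by rewrite mulmx1.
by move=> x /locf[N [oN Nx /(CclassP _ oN) fn]]; exists N; split => //; exact: fn.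
Qed.

Lemma Cclass_translation m (U : set 'rV[K]_m) (v : 'rV[K]_m) : open U ->
  Cclass a U (fun x => x + v).
Proof.
move=> oU; apply/(CclassP _ oU) => n _.
apply: mclassD; last exact: mclass_cst.
have -> : (fun x : 'rV[K]_m => x) = (fun x => x *m 1%:M).
  by apply/funext => x; rewrite mulmx1.
exact: mclass_lin.
Qed.

End ClassClosure.

Section Charts.
Variables (R : realType) (K : nonArchFieldType R) (d : nat).
Variables (M : topologicalType) (c : chart K d M).

Local Notation cimg := (cfun c @` cdom c).

Lemma chartK x : cdom c x -> cinv c (cfun c x) = x.
Proof. by move=> cx; apply: cfunK; exact: mem_set. Qed.

Lemma chart_inj x y : cdom c x -> cdom c y -> cfun c x = cfun c y -> x = y.
Proof. by move=> cx cy xy; rewrite -(chartK cx) xy chartK. Qed.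

Lemma chart_cont : cont_on (cdom c) (cfun c).
Proof. by apply/within_contP; [exact: cdom_open|exact: cfun_cont]. Qed.

Lemma chart_inv_cont : cont_on cimg (cinv c).
Proof. by apply/within_contP; [exact: cimg_open|exact: cinv_cont]. Qed.

Lemma open_preimage_on (X Y : topologicalType) (U : set X) (f : X -> Y) V :
  open U -> open V -> cont_on U f -> open (U `&` f @^-1` V).
Proof.
move=> oU oV cf; rewrite openE => x [Ux Vx].
have nU := open_nbhs_nbhs (conj oU Ux).
have nV : \forall z \near x, V (f z).
  by apply: (cf x Ux V); exact: open_nbhs_nbhs (conj oV Vx).
exact: filterI nU nV.
Qed.

Lemma chart_image_open U : open U -> open (cfun c @` (cdom c `&` U)).
Proof.
move=> oU; have -> : cfun c @` (cdom c `&` U) = cimg `&` cinv c @^-1` U.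
  apply/seteqP; split => [_ [x [cx Ux] <-]|_ [[x cx <-]]] /=.
    by rewrite chartK//; split => //; exists x.
  by rewrite chartK// => Ux; exists x.
by apply: open_preimage_on => //; [exact: cimg_open|exact: chart_inv_cont].
Qed.

End Charts.

Section Diffeomorphisms.
Variables (R : realType) (K : nonArchFieldType R) (d : nat) (a : smoothness).
Variables (M : topologicalType) (A : atlas K d a M).

Lemma loc_dom_open (c1 c2 : chart K d M) f : continuous f -> open (loc_dom c1 c2 f).
Proof.
move=> cf; apply: chart_image_open; apply: open_comp => [x _|]; first exact: cf.
exact: cdom_open.
Qed.

Lemma loc_mapE (c1 c2 : chart K d M) f x :
  cdom c1 x -> loc_map c1 c2 f (cfun c1 x) = cfun c2 (f x).
Proof. by move=> cx; rewrite /loc_map /= chartK. Qed.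

Lemma loc_domE (c1 c2 : chart K d M) f x :
  cdom c1 x -> loc_dom c1 c2 f (cfun c1 x) -> cdom c2 (f x).
Proof. by move=> cx [z [cz cfz] /(chart_inj cz cx) <-]. Qed.

(** The class of f near x, tested in a single pair of charts. *)
Definition Cmap_at f x := exists i j N, [/\ cdom (A i) x, open N,
  N (cfun (A i) x), N `<=` loc_dom (A i) (A j) f &
  Cclass a N (loc_map (A i) (A j) f)].

(** In another pair of charts the map is obtained by composing with two
    transition maps. *)
Lemma Cmap_atP f : continuous f -> Cmap A f <-> forall x, Cmap_at f x.
Proof.
move=> cf; split=> [fA x|fA].
  have [i ix] := atlas_cover A x; have [j jx] := atlas_cover A (f x).
  exists i, j, (loc_dom (A i) (A j) f); split => //; first exact: loc_dom_open.
  by exists x.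
move=> i' j'; apply: Cclass_local; first exact: loc_dom_open.
move=> _ [x [i'x j'x] <-]; have [i [j [N [ix oN Nx Nsub CN]]]] := fA x.
have jx : cdom (A j) (f x) by exact: loc_domE ix (Nsub _ Nx).
have id_cont : continuous (id : M -> M) by move=> z; exact: cvg_id.
pose D1 := loc_dom (A i') (A i) id; pose D2 := loc_dom (A j) (A j') id.
have oD1 : open D1 by exact: loc_dom_open.
have oD2 : open D2 by exact: loc_dom_open.
pose W := N `&` loc_map (A i) (A j) f @^-1` D2.
have oW : open W by apply: open_preimage_on => //; exact: Cclass_cont CN.
have CD1 : Cclass a D1 (loc_map (A i') (A i) id) by exact: atlas_compat.
have CD2 : Cclass a D2 (loc_map (A j) (A j') id) by exact: atlas_compat.
pose N' := D1 `&` loc_map (A i') (A i) id @^-1` W.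
have oN' : open N' by apply: open_preimage_on => //; exact: Cclass_cont CD1.
exists N'; split => //.
  split; first by exists x.
  by rewrite /preimage /= loc_mapE//; split => //=; rewrite loc_mapE//; exists (f x).
apply: (@Cclass_eq _ _ _ _ _ _
    (loc_map (A j) (A j') id \o loc_map (A i) (A j) f \o loc_map (A i') (A i) id)) => //.
  move=> u /set_mem[[z [i'z iz] <-]]; rewrite /preimage /= loc_mapE//= => -[Nz _].
  rewrite (loc_mapE _ _ iz) (loc_mapE _ _ i'z) loc_mapE//.
  exact: loc_domE iz (Nsub _ Nz).
apply: (@Cclass_comp _ _ _ _ _ _ _ W) => //.
- by move=> u [].
- apply: (@Cclass_comp _ _ _ _ _ _ _ D2) => //; first by move=> u [].
  by apply: Cclass_sub CN => // u [].
- by apply: Cclass_sub CD1 => // u [].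
Qed.

Lemma Cmap_at_eq f g (U : set M) x : open U -> U x -> {in U, f =1 g} ->
  Cmap_at f x -> Cmap_at g x.
Proof.
move=> oU Ux fg [i [j [N [ix oN Nx Nsub CN]]]].
pose N' := N `&` cfun (A i) @` (cdom (A i) `&` U).
have oN' : open N' by apply: openI => //; exact: chart_image_open.
exists i, j, N'; split => //.
- by split => //; exists x.
- move=> u [/Nsub Nz [z [iz Uz] zE]]; subst u.
  by exists z => //; split => //=; rewrite -fg ?inE//; exact: loc_domE Nz.
- apply: (@Cclass_eq _ _ _ _ _ _ (loc_map (A i) (A j) f)) => //.
    by move=> u /set_mem[_ [z [iz Uz] <-]]; rewrite !loc_mapE// fg// inE.
  by apply: Cclass_sub CN => // u [].
Qed.

Lemma Cmap_id : Cmap A id.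
Proof. by move=> i j; exact: atlas_compat. Qed.

Lemma Cmap_comp f g : continuous f -> continuous g ->
  Cmap A f -> Cmap A g -> Cmap A (f \o g).
Proof.
move=> cf cg fA gA; apply/Cmap_atP; first exact: homeo_comp_cont.
move=> x; have [i ix] := atlas_cover A x.
have [k kx] := atlas_cover A (g x); have [j jx] := atlas_cover A (f (g x)).
have oDf : open (loc_dom (A k) (A j) f) by exact: loc_dom_open.
have oDg : open (loc_dom (A i) (A k) g) by exact: loc_dom_open.
pose N := loc_dom (A i) (A k) g `&` loc_map (A i) (A k) g @^-1` loc_dom (A k) (A j) f.
have oN : open N by apply: open_preimage_on => //; exact: Cclass_cont (gA i k).
exists i, j, N; split => //.
- by split; [exists x|rewrite /preimage /= loc_mapE//; exists (g x)].
- move=> _ [[z [iz kz] <-]]; rewrite /preimage /= loc_mapE// => Dz.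
  by exists z => //; split => //=; exact: loc_domE Dz.
apply: (@Cclass_eq _ _ _ _ _ _ (loc_map (A k) (A j) f \o loc_map (A i) (A k) g)) => //.
  by move=> u /set_mem[[z [iz kz] <-] _] /=; rewrite !loc_mapE.
apply: (@Cclass_comp _ _ _ _ _ _ _ (loc_dom (A k) (A j) f)) => //.
  by move=> u [].
by apply: Cclass_sub (gA i k) => // u [].
Qed.

Lemma diffeo_eq (f g : diffeo A) : dval f = dval g -> f = g.
Proof.
case: f g => [f fP] [g gP] /= fg; move: fP; rewrite fg => fP.
by congr Diffeo; exact: Prop_irrelevance.
Qed.

Lemma is_diffeo_one : is_diffeo A 1%g.
Proof. by split; exact: Cmap_id. Qed.

Lemma is_diffeo_mul (f g : diffeo A) : is_diffeo A (dval f * dval g)%g.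
Proof.
have [fA fVA] := dvalP f; have [gA gVA] := dvalP g; split.
  by apply: Cmap_comp => //; exact: hfun_cont.
by rewrite invgM; apply: Cmap_comp => //; exact: hinv_cont.
Qed.

Lemma is_diffeo_inv (f : diffeo A) : is_diffeo A (dval f)^-1%g.
Proof. by have [fA fVA] := dvalP f; split; rewrite ?invgK. Qed.

Definition diffeo_one := Diffeo is_diffeo_one.
Definition diffeo_mul f g := Diffeo (is_diffeo_mul f g).
Definition diffeo_inv f := Diffeo (is_diffeo_inv f).

Lemma diffeo_mulA : associative diffeo_mul.
Proof. by move=> f g h; apply: diffeo_eq; exact: mulgA. Qed.
Lemma diffeo_mul1 : left_id diffeo_one diffeo_mul.
Proof. by move=> f; apply: diffeo_eq; exact: mul1g. Qed.
Lemma diffeo_mulr1 : right_id diffeo_one diffeo_mul.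
Proof. by move=> f; apply: diffeo_eq; exact: mulg1. Qed.
Lemma diffeo_mulV : left_inverse diffeo_one diffeo_inv diffeo_mul.
Proof. by move=> f; apply: diffeo_eq; exact: mulVg. Qed.
Lemma diffeo_mulrV : right_inverse diffeo_one diffeo_inv diffeo_mul.
Proof. by move=> f; apply: diffeo_eq; exact: mulgV. Qed.

HB.instance Definition _ := isGroup.Build (diffeo A)
  diffeo_mulA diffeo_mul1 diffeo_mulr1 diffeo_mulV diffeo_mulrV.

End Diffeomorphisms.

(** * Translations of small balls, and the automorphisms *)

Section BallTranslation.
Variables (R : realType) (K : nonArchFieldType R) (d : nat) (a : smoothness).
Variables (M : topologicalType) (A : atlas K d a M).

Lemma nball_closed m (y : 'rV[K]_m) e : closed (nball y e).
Proof.
rewrite -[nball y e]setCK; apply: open_closedC; rewrite openE => z yz.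
have [e0|e0] := ltP 0 e; last first.
  apply: filterE => u yu; apply: yz => i.
  by have := le_lt_trans (nabs_ge0 _) (yu i); rewrite ltNge e0.
apply/nballP; exists e => // u zu yu; apply: yz => i.
rewrite -(subrK (u 0 i) (y 0 i)) -addrA; apply: nabsD_lt; first exact: yu.
by rewrite nabsBC; exact: zu.
Qed.

(** By regularity of M, the closure of a small neighbourhood of y stays inside
    the domain of the chart, where the preimage of a ball is relatively
    closed. *)
Lemma clopen_chart_ball (i : aidx A) y W : compact [set: M] -> hausdorff_space M ->
  cdom (A i) y -> open W -> W y -> exists e : R, [/\ 0 < e,
    nball (cfun (A i) y) e `<=` cfun (A i) @` (cdom (A i) `&` W) &
    closed (cdom (A i) `&` cfun (A i) @^-1` nball (cfun (A i) y) e)].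
Proof.
move=> Mc Mh iy oW Wy.
have oU : open (cdom (A i) `&` W) by apply: openI => //; exact: cdom_open.
have [P yP PU] :=
  @compact_regular M y setT Mh Mc filterT _ (open_nbhs_nbhs (conj oU (conj iy Wy))).
move: yP; rewrite nbhsE => -[P' [oP' P'y] P'P].
have oI : open (cfun (A i) @` (cdom (A i) `&` P')) by exact: chart_image_open.
have Iy : (cfun (A i) @` (cdom (A i) `&` P')) (cfun (A i) y) by exists y.
have /nballP[e e0 eP] := open_nbhs_nbhs (conj oI Iy).
have PW : P' `<=` cdom (A i) `&` W.
  by move=> z /P'P /subset_closure /PU.
exists e; split => //.
  by move=> u /eP[z [iz Pz] <-]; exists z => //; exact: PW.
set S := _ `&` _.
have SP : S `<=` P'.
  by move=> z [iz /eP[z' [iz' Pz'] zE]]; rewrite -(chart_inj iz' iz zE).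
move=> z zS; have [iz _] : (cdom (A i) `&` W) z.
  by apply: PU; apply: closureS zS; exact: subset_trans P'P.
split=> //; apply: contrapT => nz.
pose V := cdom (A i) `&` cfun (A i) @^-1` (~` nball (cfun (A i) y) e).
have oV : open V.
  apply: open_preimage_on; [exact: cdom_open| |exact: chart_cont].
  by apply: closed_openC; exact: nball_closed.
have [u [[_ Su] [_ Vu]]] := zS V (open_nbhs_nbhs (conj oV (conj iz nz))).
exact: Vu.
Qed.

Section Translation.
Variables (i : aidx A) (y : M) (e : R).
Local Notation c := (A i).
Local Notation B := (nball (cfun c y) e).
Local Notation S := (cdom c `&` cfun c @^-1` B).
Hypotheses (iy : cdom c y) (Bsub : B `<=` cfun c @` cdom c) (S_closed : closed S).

(** The translation by v of the chart ball S, extended by the identity. *)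
Definition ball_shift (v : 'rV[K]_d) (x : M) : M :=
  if pselect (S x) then cinv c (cfun c x + v) else x.

Lemma S_open : open S.
Proof.
apply: open_preimage_on; [exact: cdom_open|exact: nball_open|exact: chart_cont].
Qed.

Lemma ball_shift_in v x : nball (0 : 'rV[K]_d) e v -> S x ->
  S (ball_shift v x) /\ cfun c (ball_shift v x) = cfun c x + v.
Proof.
move=> ev Sx; have [cx Bx] := Sx.
have -> : ball_shift v x = cinv c (cfun c x + v).
  by rewrite /ball_shift; case: pselect.
have Bv : B (cfun c x + v) by exact: nballD.
have [z cz zE] := Bsub Bv.
by rewrite -zE chartK//; split => //; split => //=; rewrite zE.
Qed.

Lemma ball_shift_out v x : ~ S x -> ball_shift v x = x.
Proof. by rewrite /ball_shift; case: pselect. Qed.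

Lemma ball_shiftK v : nball (0 : 'rV[K]_d) e v ->
  cancel (ball_shift v) (ball_shift (- v)).
Proof.
move=> ev x; have evN : nball (0 : 'rV[K]_d) e (- v) by exact: nball0N.
have [Sx|Sx] := pselect (S x); last by rewrite !ball_shift_out.
have [Sv vE] := ball_shift_in ev Sx; have [Svv vvE] := ball_shift_in evN Sv.
by apply: (@chart_inj _ _ _ _ c); [case: Svv|case: Sx|rewrite vvE vE addrK].
Qed.

Lemma ball_shift_cont v : nball (0 : 'rV[K]_d) e v -> continuous (ball_shift v).
Proof.
move=> ev x; have [Sx|Sx] := pselect (S x).
  have E : {in S, cinv c \o (fun z => cfun c z + v) =1 ball_shift v}.
    by move=> z /set_mem Sz; rewrite /ball_shift; case: pselect.
  apply: (cont_on_eq S_open E) (Sx).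
  apply: (@cont_on_comp _ _ _ _ (cfun c @` cdom c)); first exact: chart_inv_cont.
    move=> z [cz _]; apply: mx_contD; last exact: cst_continuous.
    exact: chart_cont.
  by move=> z [cz Bz]; apply: Bsub; exact: nballD.
have E : {in ~` S, id =1 ball_shift v}.
  by move=> z /set_mem Sz; rewrite ball_shift_out.
apply: (cont_on_eq (closed_openC S_closed) E) (Sx) => z _; exact: cvg_id.
Qed.

Lemma ball_shift_Cmap v : nball (0 : 'rV[K]_d) e v -> Cmap A (ball_shift v).
Proof.
move=> ev; apply/Cmap_atP; first exact: ball_shift_cont.
move=> x; have [Sx|Sx] := pselect (S x); last first.
  apply: (@Cmap_at_eq _ _ _ _ _ _ id _ (~` S)) => //.
  - exact: closed_openC.
  - by move=> z /set_mem Sz; rewrite ball_shift_out.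
  - by apply: (Cmap_atP A _).1; [move=> z; exact: cvg_id|exact: Cmap_id].
exists i, i, B; split.
- by case: Sx.
- exact: nball_open.
- by case: Sx.
- move=> u Bu; have [z cz zE] := Bsub Bu; exists z => //; split => //=.
  have Sz : S z by split => //=; rewrite zE.
  by have [[]] := ball_shift_in ev Sz.
apply: (@Cclass_eq _ _ _ _ _ _ (fun u => u + v)).
- exact: nball_open.
- move=> u /set_mem Bu; have [z cz zE] := Bsub Bu.
  have Sz : S z by split => //=; rewrite zE.
  by rewrite -zE loc_mapE// (ball_shift_in ev Sz).2.
- by apply: Cclass_translation; exact: nball_open.
Qed.

Lemma ball_transitive z : S z -> 0 < e -> exists2 g : diffeo A,
  (forall x, ~ S x -> dval g x = x) & dval g y = z.
Proof.
move=> [cz Bz] e0; pose v := cfun c z - cfun c y.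
have By : B (cfun c y) by move=> j; rewrite subrr nabs0.
have ev : nball (0 : 'rV[K]_d) e v by exact: nballB Bz By.
have evN : nball (0 : 'rV[K]_d) e (- v) by exact: nball0N.
have vK := ball_shiftK ev; have := ball_shiftK evN; rewrite opprK => vNK.
pose h := Homeo vK vNK (ball_shift_cont ev) (ball_shift_cont evN).
have hA : is_diffeo A h by split; exact: ball_shift_Cmap.
exists (Diffeo hA); first by move=> x Sx; exact: ball_shift_out.
have [[cv _] vE] := ball_shift_in ev (conj iy By : S y).
by apply: (chart_inj cv cz); rewrite vE addrC subrK.
Qed.

End Translation.

End BallTranslation.

Theorem mainTheorem9 (R : realType) (K : nonArchFieldType R)
    (K_infinite : infinite_set [set: K])
    (K_locally_compact : locally_compact [set: K])
    (d : nat) (d_gt0 : (0 < d)%N)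
    (alpha : smoothness)
    (M : topologicalType) (A : atlas K d alpha M)
    (M_compact : compact [set: M]) (M_hausdorff : hausdorff_space M)
    (psi : diffeo A -> diffeo A)
    (psi_auto : is_automorphism psi) (psi_cont : continuous psi) :
  exists h : homeo M, forall g : diffeo A,
    dval (psi g) = (h * dval g * h^-1)%g.
Proof.
have [[phi psiK phiK] psi_mul] := psi_auto.
have psi_iso : inverse_morphisms psi phi.
  by split => // f g; apply: diffeo_eq; exact: psi_mul.
pose act (g : diffeo A) := hfun (dval g).
have no_isolated x (W : set M) : open W -> W x -> exists2 y, W y & y <> x.
  move=> oW Wx; have [i ix] := atlas_cover A x.
  have oI : open (cfun (A i) @` (cdom (A i) `&` W)) by exact: chart_image_open.
  have Ix : (cfun (A i) @` (cdom (A i) `&` W)) (cfun (A i) x) by exists x.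
  have /nballP[e e0 eI] := open_nbhs_nbhs (conj oI Ix).
  have [t t0 te] := small_unit K e0.
  have /eI[y [iy Wy] yE] : nball (cfun (A i) x) e (cfun (A i) x + const_mx t).
    by move=> j; rewrite !mxE opprD addNKr nabsN.
  exists y => // yx; move: yE; rewrite yx => /rowP/(_ (Ordinal d_gt0)).
  rewrite !mxE => /eqP; rewrite -subr_eq0 opprD addNKr oppr_eq0.
  by rewrite (negbTE t0).
have locally_transitive x (W : set M) : open W -> W x -> exists N,
    [/\ open N, N x & forall y, N y -> exists2 g, rigid act W g & act g x = y].
  move=> oW Wx; have [i ix] := atlas_cover A x.
  have [e [e0 eW eS]] := clopen_chart_ball M_compact M_hausdorff ix oW Wx.
  set B := nball (cfun (A i) x) e in eW eS.
  have Bsub : B `<=` cfun (A i) @` cdom (A i).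
    by move=> u /eW[z [iz _] <-]; exists z.
  exists (cdom (A i) `&` cfun (A i) @^-1` B); split.
  - exact: S_open.
  - by split => // j; rewrite subrr nabs0.
  move=> y Sy; have [g gS gx] := ball_transitive ix Bsub eS Sy e0.
  exists g => // z gz; apply: contrapT => Wz; apply/gz/gS => -[iz /eW[z' [iz' Wz'] zE]].
  by apply: Wz; rewrite -(chart_inj iz' iz zE).
have [h [h' [hK h'K ch ch' hE]]] : exists h h' : M -> M,
    [/\ cancel h h', cancel h' h, continuous h, continuous h' &
    forall g x, h (act g x) = act (psi g) (h x)].
  apply: (@reconstruction M (diffeo A) act) psi_iso => //.
  - by move=> g; exact: hfun_cont.
  - move=> g g1; apply: diffeo_eq; apply: homeo_eq; exact/funext.
exists (Homeo hK h'K ch ch') => g; apply: homeo_eq; apply/funext => x /=.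
by rewrite hE h'K.
Qed.
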